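(* Let $n\in\mathbb{N}$ and let $K\subset\mathbb{R}^n$ be a $0$-symmetric convex body. Then \[ G(K)\le 3^{n-1}\bigl(G(\operatorname{int}K)+2\bigr). \] Moreover, equality holds if and only if $K$ is unimodularly equivalent to the parallelepiped $[-1,1]^{n-1}\times[-\ell,\ell]$ for some $\ell\in\mathbb{N}$.
   Context: A convex body in $\mathbb{R}^n$ is a compact convex set with nonempty interior; it is $0$-symmetric if $K=-K$. For $S\subset\mathbb{R}^n$, $G(S)=|S\cap\mathbb{Z}^n|$ denotes the number of integer points in $S$, and $\operatorname{int}K$ is the interior of $K$. Two sets $K,K'$ are unimodularly equivalent if $K=AK'=\{Ax:x\in K'\}$ for some integer matrix $A\in\mathbb{Z}^{n\times n}$ whose inverse is also an integer matrix. *)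

(* Defs.v *)
From mathcomp Require Import ssreflect ssrbool eqtype ssrnat seq fintype.
From Stdlib Require Import Reals ZArith List.

Set Implicit Arguments.
Unset Strict Implicit.

Definition vecR (n : nat) := 'I_n -> R.
Definition vecZ (n : nat) := 'I_n -> Z.

Definition rsum (n : nat) (f : 'I_n -> R) : R :=
  List.fold_right Rplus 0%R (List.map f (enum 'I_n)).
Definition zsum (n : nat) (f : 'I_n -> Z) : Z :=
  List.fold_right Z.add 0%Z (List.map f (enum 'I_n)).

Definition embZ (n : nat) (z : vecZ n) : vecR n := fun i => IZR (z i).

Definition near (n : nat) (x y : vecR n) (eps : R) : Prop :=
  forall i : 'I_n, (Rabs (y i - x i) < eps)%R.

Definition int_set (n : nat) (K : vecR n -> Prop) : vecR n -> Prop :=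
  fun x => exists eps : R, (0 < eps)%R /\ forall y, near x y eps -> K y.

Definition is_closed (n : nat) (K : vecR n -> Prop) : Prop :=
  forall x : vecR n,
    (forall eps : R, (0 < eps)%R -> exists y, K y /\ near x y eps) -> K x.

Definition is_bounded (n : nat) (K : vecR n -> Prop) : Prop :=
  exists M : R, forall x, K x -> forall i : 'I_n, (Rabs (x i) <= M)%R.

Definition is_compact (n : nat) (K : vecR n -> Prop) : Prop :=
  is_closed K /\ is_bounded K.

Definition is_convex (n : nat) (K : vecR n -> Prop) : Prop :=
  forall (x y : vecR n) (t : R), (0 <= t <= 1)%R -> K x -> K y ->
    K (fun i => t * x i + (1 - t) * y i)%R.

Definition convex_body (n : nat) (K : vecR n -> Prop) : Prop :=
  is_compact K /\ is_convex K /\ exists x, int_set K x.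

Definition o_symmetric (n : nat) (K : vecR n -> Prop) : Prop :=
  forall x : vecR n, K x <-> K (fun i => - x i)%R.

Definition G_eq (n : nat) (S : vecR n -> Prop) (m : nat) : Prop :=
  exists l : list (vecZ n), List.NoDup l /\ List.length l = m /\
    forall z : vecZ n, List.In z l <-> S (embZ z).

Definition zmat (n : nat) := 'I_n -> 'I_n -> Z.

Definition zmat_apply (n : nat) (A : zmat n) (x : vecR n) : vecR n :=
  fun i => rsum (fun j => IZR (A i j) * x j)%R.

Definition zmat_mul (n : nat) (A B : zmat n) : zmat n :=
  fun i k => zsum (fun j => A i j * B j k)%Z.

Definition zmat_id (n : nat) : zmat n :=
  fun i j => if i == j then 1%Z else 0%Z.

Definition unimodular (n : nat) (A : zmat n) : Prop :=
  exists B : zmat n,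
    (forall i j, zmat_mul A B i j = zmat_id i j) /\
    (forall i j, zmat_mul B A i j = zmat_id i j).

Definition unimod_equiv (n : nat) (K K' : vecR n -> Prop) : Prop :=
  exists A : zmat n, unimodular A /\
    forall x : vecR n, K x <-> exists y, K' y /\ forall i, x i = zmat_apply A y i.

(* The parallelepiped [-1,1]^{n-1} x [-l,l]  (last coordinate is index n-1). *)
Definition box (n l : nat) : vecR n -> Prop :=
  fun y => forall i : 'I_n,
    if Nat.ltb (nat_of_ord i) (n - 1) then (-1 <= y i <= 1)%R
    else (- INR l <= y i <= INR l)%R.
Arguments box : clear implicits.

(* Main.v *)
(** Let N be the gauge of K, so that K = {N <= 1} and int K = {N < 1}.

    If 0 is the only interior lattice point, two lattice points of K that are
    congruent mod 3 coincide, since a third of their difference is interior;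
    hence G(K) <= 3^n.  Otherwise take an interior lattice point v <> 0 of
    minimal gauge and the largest m with m v interior, and split the lattice points of K into
    the 3^(n-1) classes modulo 3 Z^n + Z v.  A class is a union of segments
    parallel to v, each with at most 2m+3 points.  For x, y in a class and
    |k| <= m, the lattice points of the form (x - y + k v) / 3 are interior.
    Ordering the segments by a generic linear functional that vanishes on v
    yields enough distinct differences to show that the class has at most
    G(int K) + 2 points, with equality only for a single segment of 2m+3
    points.

    In case of equality the points x with x + m v and x - m v in K form a convex
    body without nonzero interior lattice point which meets every class modulo
    3 Z^n.  In such a body some lattice point v lies on one facet only; then the
    lattice points are v-lines of three points, and recursion on the kernel of
    the facet functional gives a lattice basis in which the body is a cube. *)

Require Import Defs.
From mathcomp Require Import ssreflect ssrfun ssrbool eqtype ssrnat seq fintype.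
From Stdlib Require Import Reals ZArith List Lra FunctionalExtensionality ClassicalEpsilon.

Set Implicit Arguments.
Unset Strict Implicit.
Unset Printing Implicit Defensive.

(** * The gauge of a symmetric convex body *)

Lemma Rabs_leP (x a : R) : (Rabs x <= a <-> - a <= x <= a)%R.
Proof.
split=> [h|]; last exact: Rabs_le.
by have := Rle_abs x; have := Rle_abs (- x); rewrite Rabs_Ropp; lra.
Qed.

Section Gauge.
Local Open Scope R_scope.

Lemma finite_bound n (x : vecR n) : exists B, 0 < B /\ forall i, Rabs (x i) <= B.
Proof.
suff [B [B0 hB]] : exists B, 0 < B /\ forall i, i \in enum 'I_n -> Rabs (x i) <= B.
  by exists B; split=> // i; apply: hB; rewrite mem_enum.
elim: (enum 'I_n) => [|i s [B [B0 hB]]]; first by exists 1; split; [lra|].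
exists (Rmax B (Rabs (x i))); split; first by apply: Rlt_le_trans (Rmax_l _ _).
move=> j; rewrite inE => /orP[/eqP ->|/hB h]; first exact: Rmax_r.
exact: Rle_trans h (Rmax_l _ _).
Qed.

Variables (n : nat) (K : vecR n -> Prop).
Hypotheses (bodyK : convex_body K) (symK : o_symmetric K).

Let ext x y : K x -> (forall i, x i = y i) -> K y.
Proof. by move=> Kx /functional_extensionality <-. Qed.

Lemma body_opp x : K x -> K (fun i => - x i).
Proof. by move=> Kx; exact: (proj1 (symK x)). Qed.

(** For an interior point [x], the midpoints of [x + 2 y] and [- x] fill a cube around the
    origin. *)
Lemma body_contains_cube : exists d, 0 < d /\ forall y, (forall i, Rabs (y i) < d) -> K y.
Proof.
have [_ [conv [x [eps [e0 he]]]]] := bodyK.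
exists (eps / 2); split; first lra.
move=> y hy.
have Kx : K x by apply: he => i; rewrite Rminus_diag Rabs_R0.
have K1 : K (fun i => x i + 2 * y i).
  apply: he => i; have -> : x i + 2 * y i - x i = 2 * y i by lra.
  by rewrite Rabs_mult Rabs_pos_eq; [have := hy i; lra | lra].
have h : 0 <= 1 / 2 <= 1 by lra.
apply: ext (conv _ _ _ h K1 (body_opp Kx)) _ => i; lra.
Qed.

Lemma body_scale x t : 0 <= t <= 1 -> K x -> K (fun i => t * x i).
Proof.
move=> ht Kx; have [_ [conv _]] := bodyK.
have [d [d0 hd]] := body_contains_cube.
have K0 : K (fun=> 0) by apply: hd => i; rewrite Rabs_R0.
apply: ext (conv _ _ _ ht Kx K0) _ => i; lra.
Qed.

(* [r] is the infimum of the [t > 0] with [x / t] in [K]. *)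
Definition is_gauge_value (x : vecR n) (r : R) :=
  [/\ 0 <= r, forall t, r < t -> K (fun i => / t * x i)
    & forall t, 0 < t -> K (fun i => / t * x i) -> r <= t].

Lemma gauge_value_exists x : exists r, is_gauge_value x r.
Proof.
(* [completeness] yields suprema, so the infimum over [t] is taken as minus the supremum over
   [- t]. *)
pose E s := exists t, [/\ 0 < t, s = - t & K (fun i => / t * x i)].
have bE : bound E by exists 0 => s [t [t0 -> _]]; lra.
have [d [d0 hd]] := body_contains_cube.
have [B [B0 hB]] := finite_bound x.
have nE : exists s, E s.
  exists (- (2 * B / d)), (2 * B / d).
  have t0 : 0 < 2 * B / d by apply: Rdiv_lt_0_compat; lra.
  split=> //; apply: hd => i; rewrite Rabs_mult Rabs_pos_eq; last exact/Rlt_le/Rinv_0_lt_compat.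
  apply: (Rmult_lt_reg_l (2 * B / d)) => //.
  rewrite -Rmult_assoc Rinv_r; last lra.
  have -> : 2 * B / d * d = 2 * B by field; lra.
  have := hB i; lra.
have [s [ub lub]] := completeness E bE nE.
exists (- s); split.
- have : s <= 0 by apply: lub => u [t [t0 -> _]]; lra.
  lra.
- move=> t ht.
  have [t' [t'0 t't Kt']] : exists t', [/\ 0 < t', t' < t & K (fun i => / t' * x i)].
    apply: NNPP => H.
    have : s <= - t; last by lra.
    apply: lub => u [t' [t'0 -> Kt']].
    have [h|h] := Rlt_le_dec t' t; last by lra.
    by case: H; exists t'.
  have ht' : 0 <= t' / t <= 1.
    split; first by apply: Rlt_le; apply: Rdiv_lt_0_compat; lra.
    apply: (Rmult_le_reg_r t); first lra.
    have -> : t' / t * t = t' by field; lra.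
    lra.
  apply: ext (body_scale ht' Kt') _ => i; field; lra.
- move=> t t0 Kt; have : - t <= s by apply: ub; exists t.
  lra.
Qed.

(** Closedness of [K] gives [K = {N <= 1}], symmetry gives the absolute value in homogeneity, and
    boundedness gives definiteness. *)
Lemma gauge_exists : exists N : vecR n -> R,
  [/\ forall x y, N (fun i => x i + y i) <= N x + N y,
      forall x t, N (fun i => t * x i) = Rabs t * N x,
      forall x, K x <-> N x <= 1,
      forall x, int_set K x <-> N x < 1
    & forall x, N x = 0 -> forall i, x i = 0].
Proof.
pose N x := proj1_sig (constructive_indefinite_description _ (gauge_value_exists x)).
have NP x : is_gauge_value x (N x) by apply: proj2_sig.
have [[closedK [M hM]] [conv _]] := bodyK.
have [d [d0 hd]] := body_contains_cube.
have Nge0 x : 0 <= N x by case: (NP x).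
have Nlt x t : N x < t -> K (fun i => / t * x i) by case: (NP x) => _ h _; apply: h.
have Nle x t : 0 < t -> K (fun i => / t * x i) -> N x <= t.
  by case: (NP x) => _ _ h; apply: h.
have KN x : K x <-> N x <= 1.
  split=> [Kx|Nx]; first by apply: Nle; [lra | apply: ext Kx _ => i; rewrite Rinv_1; lra].
  apply: closedK => eps e0; have [B [B0 hB]] := finite_bound x.
  (* With this [s] the point [x / (1 + s)] of [K] is within [eps / 2] of [x], so closedness
     applies. *)
  pose s := eps / (2 * B).
  have s0 : 0 < s by apply: Rdiv_lt_0_compat; lra.
  have sB : s * (2 * B) = eps by rewrite /s; field; lra.
  exists (fun i => / (1 + s) * x i); split; first by apply: Nlt; lra.
  move=> i; have -> : / (1 + s) * x i - x i = - (s / (1 + s)) * x i by field; lra.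
  have hs : 0 <= s / (1 + s) <= s.
    split; first by apply: Rlt_le; apply: Rdiv_lt_0_compat; lra.
    apply: (Rmult_le_reg_r (1 + s)); first lra.
    have -> : s / (1 + s) * (1 + s) = s by field; lra.
    nra.
  rewrite Rabs_mult Rabs_Ropp Rabs_pos_eq; last lra.
  have := hB i; have := Rabs_pos (x i); nra.
have Npos x t : 0 < t -> N (fun i => t * x i) <= t * N x.
  move=> t0; apply: le_epsilon => eps e0.
  have e1 : 0 < eps / t by apply: Rdiv_lt_0_compat.
  have -> : t * N x + eps = t * (N x + eps / t) by field; lra.
  have hc : N x < N x + eps / t by lra.
  move: (N x + eps / t) hc => c hc; have c0 : 0 < c by have := Nge0 x; lra.
  apply: Nle; first exact: Rmult_lt_0_compat.
  by apply: ext (Nlt x c hc) _ => i; field; lra.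
have Nopp x : N (fun i => - x i) <= N x.
  apply: le_epsilon => eps e0; apply: Nle; first by have := Nge0 x; lra.
  apply: ext (body_opp (Nlt x (N x + eps) _)) _; first lra.
  by move=> i /=; lra.
have Next x y : (forall i, x i = y i) -> N x = N y.
  by move=> /functional_extensionality ->.
have Npos' x t : 0 < t -> N (fun i => t * x i) = t * N x.
  move=> t0; apply: Rle_antisym; first exact: Npos.
  have := Npos (fun i => t * x i) (/ t) (Rinv_0_lt_compat _ t0).
  rewrite (@Next _ x) => [h|i]; last by field; lra.
  apply: (Rmult_le_reg_l (/ t)); first exact: Rinv_0_lt_compat.
  by rewrite -Rmult_assoc Rinv_l; [lra|lra].
have Nopp' x : N (fun i => - x i) = N x.
  apply: Rle_antisym; first exact: Nopp.
  have := Nopp (fun i => - x i); rewrite (@Next _ x) // => i; lra.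
exists N; split=> //.
- move=> x y; apply: le_epsilon => eps e0.
  have [hx hy] := (Nge0 x, Nge0 y).
  pose a := N x + eps / 2; pose b := N y + eps / 2.
  have -> : N x + N y + eps = a + b by rewrite /a /b; lra.
  have a0 : 0 < a by rewrite /a; lra.
  have b0 : 0 < b by rewrite /b; lra.
  apply: Nle; first lra.
  (* [(x + y) / (a + b)] is the combination of [x / a] and [y / b] with weights [a / (a + b)] and
     [b / (a + b)]. *)
  have ht : 0 <= a / (a + b) <= 1.
    split; first by apply: Rlt_le; apply: Rdiv_lt_0_compat; lra.
    apply: (Rmult_le_reg_r (a + b)); first lra.
    have -> : a / (a + b) * (a + b) = a by field; lra.
    lra.
  have Kx : K (fun i => / a * x i) by apply: Nlt; rewrite /a; lra.
  have Ky : K (fun i => / b * y i) by apply: Nlt; rewrite /b; lra.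
  apply: ext (conv _ _ _ ht Kx Ky) _ => i; field; lra.
- move=> x t; have [t0|[->|t0]] := Rtotal_order t 0.
  + rewrite Rabs_left // -Npos'; last lra.
    by rewrite -Nopp'; apply: Next => i; lra.
  + rewrite Rabs_R0 Rmult_0_l; apply: Rle_antisym => //.
    apply: le_epsilon => eps e0; apply: Nle; first lra.
    by apply: hd => i; rewrite Rmult_0_l Rmult_0_r Rabs_R0.
  + by rewrite Rabs_pos_eq ?Npos' //; lra.
- move=> x; split=> [[eps [e0 he]]|Nx].
    have [B [B0 hB]] := finite_bound x.
    pose s := eps / (2 * B).
    have s0 : 0 < s by apply: Rdiv_lt_0_compat; lra.
    have sB : s * (2 * B) = eps by rewrite /s; field; lra.
    have : N (fun i => (1 + s) * x i) <= 1.
      apply/KN/he => i; have -> : (1 + s) * x i - x i = s * x i by lra.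
      rewrite Rabs_mult Rabs_pos_eq; last lra.
      have := hB i; have := Rabs_pos (x i); nra.
    rewrite Npos'; last lra.
    have := Nge0 x; nra.
  (* Since [N x < t < 1], a point near [x] is [t] times the point [x / t] of [K] plus [1 - t] times
     a point of the cube of half-width [d]. *)
  pose t := (1 + N x) / 2.
  have ht : 0 <= t <= 1 by rewrite /t; have := Nge0 x; lra.
  have t0 : 0 < t by rewrite /t; have := Nge0 x; lra.
  have Kx : K (fun i => / t * x i) by apply: Nlt; rewrite /t; lra.
  exists ((1 - t) * d); split; first by apply: Rmult_lt_0_compat => //; rewrite /t; lra.
  have t1 : 0 < 1 - t by rewrite /t; lra.
  move=> y hy.
  have Ky : K (fun i => / (1 - t) * (y i - x i)).
    apply: hd => i; rewrite Rabs_mult Rabs_pos_eq; last exact/Rlt_le/Rinv_0_lt_compat.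
    apply: (Rmult_lt_reg_l (1 - t)) => //.
    by rewrite -Rmult_assoc Rinv_r ?Rmult_1_l; [apply: hy | lra].
  apply: ext (conv _ _ _ ht Kx Ky) _ => i; field; lra.
- move=> x Nx i; apply: NNPP => xi.
  have xp : 0 < Rabs (x i) by apply: Rabs_pos_lt.
  have M0 : 0 <= M.
    have K0 : K (fun=> 0) by apply: hd => j; rewrite Rabs_R0.
    by have := hM _ K0 i; rewrite /= Rabs_R0.
  (* Coordinate [i] of [x / t] has absolute value [2 (M + 1)], beyond the bound [M]. *)
  pose t := Rabs (x i) / (2 * (M + 1)).
  have t0 : 0 < t by apply: Rdiv_lt_0_compat; lra.
  have := hM _ (Nlt x t _) i; rewrite Nx => /(_ t0).
  rewrite Rabs_mult Rabs_pos_eq; last exact/Rlt_le/Rinv_0_lt_compat.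
  have -> : / t * Rabs (x i) = 2 * (M + 1) by rewrite /t; field; lra.
  lra.
Qed.

End Gauge.

(** * Norms whose unit ball is a box *)

Section NormBox.
Local Open Scope R_scope.
Variables (n : nat) (g : vecR n.+1 -> R).
Hypothesis gD : forall x y, g (fun i => x i + y i) <= g x + g y.
Hypothesis gZ : forall x t, g (fun i => t * x i) = Rabs t * g x.

Let gext x y : (forall i, x i = y i) -> g x = g y.
Proof. by move=> /functional_extensionality ->. Qed.

Lemma norm_convex x y z a b : 0 <= a -> 0 <= b ->
  (forall i, z i = a * x i + b * y i) -> g z <= a * g x + b * g y.
Proof.
move=> a0 b0 e; rewrite (gext e); apply: Rle_trans (gD _ _) _.
by rewrite !gZ !Rabs_pos_eq //; apply: Rle_refl.
Qed.

(** A convex function on a cube is largest at a vertex. The induction frees one coordinate at a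
    time: only those below [k] may differ from 1 and -1. *)
Lemma norm_cube_vertices (w : vecR n.+1) :
  (forall c, (forall i, c i = 1 \/ c i = -1) -> g (fun i => c i + w i) <= 1) ->
  forall c, (forall i, Rabs (c i) <= 1) -> g (fun i => c i + w i) <= 1.
Proof.
move=> vert.
suff H k c : (forall i, Rabs (c i) <= 1) ->
    (forall i : 'I_n.+1, (k <= i)%nat -> c i = 1 \/ c i = -1) -> g (fun i => c i + w i) <= 1.
  by move=> c hc; apply: (H n.+1) => // i; rewrite leqNgt ltn_ord.
elim: k c => [|k IH] c hc hs; first by apply: vert => i; apply: hs.
have [kn|kn] := ltnP k n.+1; last first.
  by apply: IH => // i ki; have := leq_ltn_trans ki (ltn_ord i); rewrite ltnNge kn.
pose o := Ordinal kn.
pose d (s : R) := fun i => if i == o then s else c i.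
have gd s : s = 1 \/ s = -1 -> g (fun i => d s i + w i) <= 1.
  move=> hs1; apply: IH => i; rewrite /d; case: eqP => [_|io] //.
    case: hs1 => ->; [rewrite Rabs_R1 | rewrite Rabs_left]; lra.
  move=> ki; apply: hs; rewrite ltn_neqAle ki andbT.
  by apply/eqP => e; apply: io; apply: val_inj.
have h1 : g (fun i => d 1 i + w i) <= 1 by apply: gd; left.
have h2 : g (fun i => d (-1) i + w i) <= 1 by apply: gd; right.
have /Rabs_leP [lo hi] := hc o.
apply: Rle_trans (norm_convex (a := (1 + c o) / 2) (b := (1 - c o) / 2)
  (x := fun i => d 1 i + w i) (y := fun i => d (-1) i + w i) _ _ _) _.
- lra.
- lra.
- by move=> i; rewrite /d; case: eqP => [->|_]; lra.
nra.
Qed.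

Variable m : nat.
(** The half-widths of [box n.+1 m.+1]; the shift by one leaves out the flat box, and [m] will be
    the largest multiple of the direction vector inside the interior. *)
Definition box_radius (i : 'I_n.+1) : R := if i == ord_max then INR m + 1 else 1.

Hypothesis vertices : forall c, (forall i, c i = 1 \/ c i = -1) ->
  g (fun i => c i + (if i == ord_max then INR m else 0)) <= 1 /\
  g (fun i => c i + (if i == ord_max then - INR m else 0)) <= 1.
Hypothesis facets : forall j, 1 <= g (fun i => if i == j then box_radius j else 0).

Lemma box_radius_ge1 i : 1 <= box_radius i.
Proof. by rewrite /box_radius; case: eqP => _; have := pos_INR m; lra. Qed.

(** The box is the Minkowski sum of the cube of half-width 1 and the segment between [- m e] and
    [m e], where [e] is the last unit vector. Convexity in each summand reduces the claim to
    [vertices]. *)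
Lemma norm_le1_of_box y : (forall i, Rabs (y i) <= box_radius i) -> g y <= 1.
Proof.
move=> hy.
have [c [u [hc hu ey]]] : exists c u, [/\ Rabs c <= 1, Rabs u <= INR m & y ord_max = c + u].
  have := hy ord_max; rewrite /box_radius eqxx; move: (y ord_max) => yl /Rabs_leP hyl.
  have := pos_INR m => m0.
  have [h1|h1] := Rlt_le_dec 1 yl.
    by exists 1, (yl - 1); split; [rewrite Rabs_R1 | apply/Rabs_leP|]; lra.
  have [h2|h2] := Rlt_le_dec yl (-1).
    by exists (-1), (yl + 1); split; [rewrite Rabs_left | apply/Rabs_leP|]; lra.
  by exists yl, 0; split; [apply/Rabs_leP | rewrite Rabs_R0 |]; lra.
have [mu [hmu eu]] : exists mu, -1 <= mu <= 1 /\ u = mu * INR m.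
  have := pos_INR m => m0; have /Rabs_leP hu' := hu.
  have [m1|m1] := Req_dec (INR m) 0; first by exists 0; split; nra.
  exists (u / INR m); split; last by field.
  have m2 : 0 < INR m by lra.
  have E : u / INR m * INR m = u by field.
  by split; apply: (Rmult_le_reg_r (INR m)) => //; rewrite E; lra.
pose c' := fun i => if i == ord_max then c else y i.
have hc' i : Rabs (c' i) <= 1.
  by rewrite /c'; case: eqP => // /eqP /negPf ni; have := hy i; rewrite /box_radius ni.
have hp := norm_cube_vertices (fun d hd => proj1 (vertices hd)) hc'.
have hm := norm_cube_vertices (fun d hd => proj2 (vertices hd)) hc'.
apply: Rle_trans (norm_convex (a := (1 + mu) / 2) (b := (1 - mu) / 2)
   (x := fun i => c' i + (if i == ord_max then INR m else 0))
   (y := fun i => c' i + (if i == ord_max then - INR m else 0)) _ _ _) _; try lra.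
- by move=> i; rewrite /c'; case: eqP => [->|_]; rewrite ?ey ?eu; lra.
- nra.
Qed.

(** If [y j] exceeds its bound by a factor [q > 1], the centre of facet [j] is [t y + z] with [z] in
    the box scaled by [1 - t q]. Its norm is then at most [1 - t q + t < 1], against [facets]. *)
Lemma box_of_norm_le1 y j : g y <= 1 -> y j <= box_radius j.
Proof.
move=> gy; apply: Rnot_lt_le => hj.
have [B [B0 hB]] := finite_bound y.
pose t := / (4 * B); have t0 : 0 < t by apply: Rinv_0_lt_compat; lra.
have tB : t * B = / 4 by rewrite /t; field; lra.
have l1 := box_radius_ge1 j.
have hyj := hB j; rewrite Rabs_pos_eq in hyj; last lra.
pose q := y j / box_radius j.
have eq : q * box_radius j = y j by rewrite /q; field; lra.
have q1 : 1 < q by nra.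
have qB : t * q <= / 4 by rewrite -tB; apply: Rmult_le_compat_l; [lra | nra].
pose rho := 1 - t * q.
pose z := fun i => (if i == j then box_radius j else 0) - t * y i.
have gz : g z <= rho.
  have r0 : 0 < rho by rewrite /rho; lra.
  have := gZ (fun i => / rho * z i) rho; rewrite Rabs_pos_eq; last lra.
  rewrite (gext (y := z)) => [->|i]; last by field; lra.
  suff : g (fun i => / rho * z i) <= 1 by nra.
  apply: norm_le1_of_box => i; rewrite Rabs_mult Rabs_pos_eq; last exact/Rlt_le/Rinv_0_lt_compat.
  apply: (Rmult_le_reg_l rho) => //; rewrite -Rmult_assoc Rinv_r ?Rmult_1_l; last lra.
  have l1i := box_radius_ge1 i.
  rewrite /z; case: eqP => [->|_].
    rewrite Rabs_pos_eq; rewrite -?eq /rho; nra.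
  rewrite Rminus_0_l Rabs_Ropp Rabs_mult Rabs_pos_eq; last lra.
  have : t * Rabs (y i) <= t * B by apply: Rmult_le_compat_l; [lra | apply: hB].
  rewrite /rho; nra.
have := facets j.
have : g (fun i => if i == j then box_radius j else 0) <= 1 * g z + t * g y.
  by apply: norm_convex; [lra | lra | move=> i; rewrite /z; lra].
rewrite /rho in gz; nra.
Qed.

Lemma norm_box y : g y <= 1 <-> forall i, Rabs (y i) <= box_radius i.
Proof.
split=> [gy i|]; last exact: norm_le1_of_box.
apply/Rabs_leP; split; last exact: box_of_norm_le1.
have : g (fun i => -1 * y i) <= 1.
  by rewrite gZ Rabs_left; lra.
move=> h; have := box_of_norm_le1 i h; lra.
Qed.

End NormBox.

Lemma box_radiusE n m (y : vecR n.+1) :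
  box n.+1 m.+1 y <-> forall i, (Rabs (y i) <= box_radius m i)%R.
Proof.
suff H (i : 'I_n.+1) : Nat.ltb i (n.+1 - 1) = (i != ord_max).
  split=> h i; have := h i; rewrite H /box_radius S_INR; case: eqP => /= _.
  - by move=> h1; apply/Rabs_leP; lra.
  - by move=> h1; apply/Rabs_leP; lra.
  - by move/Rabs_leP; lra.
  - by move/Rabs_leP; lra.
rewrite subn1 /=; apply/idP/idP => [/Nat.ltb_lt/ltP h|h].
  by apply/eqP => e; move: h; rewrite e ltnn.
apply/Nat.ltb_lt/ltP; rewrite ltn_neqAle -ltnS ltn_ord andbT.
by move: h; apply: contraNneq => h; apply/eqP/val_inj.
Qed.

(** * Shrinking a body along a segment *)

Section Core.
Local Open Scope R_scope.
Variables (n : nat) (K : vecR n -> Prop) (w : vecR n).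

(* [K] shrunk along the segment from [- w] to [w]. *)
Definition core (x : vecR n) := K (fun i => x i + w i) /\ K (fun i => x i - w i).

Lemma int_core x : int_set core x ->
  int_set K (fun i => x i + w i) /\ int_set K (fun i => x i - w i).
Proof.
have eqf (f : vecR n -> Prop) a b : (forall i, a i = b i) -> f a -> f b.
  by move=> /functional_extensionality ->.
move=> [eps [e0 he]]; split; exists eps; split=> // y hy.
  have [h _] : core (fun i => y i - w i).
    apply: he => i; rewrite (_ : y i - w i - x i = y i - (x i + w i)); [exact: hy | lra].
  by apply: eqf h => i; lra.
have [_ h] : core (fun i => y i + w i).
  apply: he => i; rewrite (_ : y i + w i - x i = y i - (x i - w i)); [exact: hy | lra].
by apply: eqf h => i; lra.
Qed.

Hypotheses (bodyK : convex_body K) (symK : o_symmetric K) (intw : int_set K w).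

Let ext x y : K x -> (forall i, x i = y i) -> K y.
Proof. by move=> Kx /functional_extensionality <-. Qed.

Lemma core_sub x : core x -> K x.
Proof.
move=> [k1 k2]; have [_ [conv _]] := bodyK.
have h : 0 <= 1 / 2 <= 1 by lra.
by apply: ext (conv _ _ _ h k1 k2) _ => i; lra.
Qed.

Lemma core_symmetric : o_symmetric core.
Proof.
have half x : core x -> core (fun i => - x i).
  move=> [/(body_opp symK) k1 /(body_opp symK) k2]; split.
    by apply: ext k2 _ => i /=; lra.
  by apply: ext k1 _ => i /=; lra.
move=> x; split=> [|/half]; first exact: half.
by have -> : (fun i => - - x i) = x by apply/functional_extensionality => i; lra.
Qed.

Lemma core_body : convex_body core.
Proof.
have [[closedK [M hM]] [conv _]] := bodyK.
split; [split | split].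
- move=> x hx; split; apply: closedK => eps e0; have [y [[k1 k2] hy]] := hx eps e0.
    exists (fun i => y i + w i); split=> // i.
    rewrite (_ : y i + w i - (x i + w i) = y i - x i); [exact: hy | lra].
  exists (fun i => y i - w i); split=> // i.
  rewrite (_ : y i - w i - (x i - w i) = y i - x i); [exact: hy | lra].
- by exists M => x /core_sub; apply: hM.
- move=> x y t ht [kx1 kx2] [ky1 ky2]; split.
    by apply: ext (conv _ _ _ ht kx1 ky1) _ => i /=; lra.
  by apply: ext (conv _ _ _ ht kx2 ky2) _ => i /=; lra.
(* The origin is interior to the core because [w] and, by symmetry, [- w] are interior to [K]. *)
exists (fun=> 0); have [eps [e0 he]] := intw; exists eps; split=> // y hy; split.
  apply: he => i; rewrite (_ : y i + w i - w i = y i - 0); [exact: hy | lra].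
have k : K (fun i => w i - y i).
  by apply: he => i; rewrite (_ : w i - y i - w i = - (y i - 0)) ?Rabs_Ropp; [exact: hy | lra].
by apply: ext (body_opp symK k) _ => i; lra.
Qed.

End Core.

From Stdlib Require FinFun.
From mathcomp Require Import all_boot all_order all_fingroup all_algebra.
From mathcomp Require Import ring lra zify ssrZ boolp Rstruct.

Import Order.TTheory GRing.Theory Num.Theory.
Local Open Scope ring_scope.
Delimit Scope R_scope with coqR.

(** * Norms on abelian groups and the equality case of Minkowski's 3^n theorem *)

Section Norm.
Variables (R : archiRealFieldType) (M : zmodType) (N : M -> R).

(** What remains of a seminorm on a lattice: homogeneity concerns natural multiples only, and
    nonnegativity follows in [norm_ge0]. *)
Definition group_norm :=
  [/\ forall x y, N (x + y) <= N x + N y,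
      forall x, N (- x) = N x &
      forall x k, N (x *+ k) = k%:R * N x].

Hypothesis Nn : group_norm.

Lemma normD x y : N (x + y) <= N x + N y. Proof. by case: Nn. Qed.
Lemma normN x : N (- x) = N x. Proof. by case: Nn. Qed.
Lemma normMn x k : N (x *+ k) = k%:R * N x. Proof. by case: Nn. Qed.

Lemma norm0 : N 0 = 0.
Proof. by rewrite -(mulr0n 0) normMn mul0r. Qed.

Lemma normB x y : N (x - y) <= N x + N y.
Proof. by rewrite -(normN y) normD. Qed.

Lemma norm_ge0 x : 0 <= N x.
Proof. by have := normB x x; rewrite subrr norm0; lra. Qed.

Lemma normMz x (a : int) : N (x *~ a) = `|a|%:~R * N x.
Proof.
case: a => k; first by rewrite -pmulrn normMn.
by rewrite NegzE mulrNz normN -pmulrn normMn normrN.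
Qed.

Lemma norm_sum (I : Type) (r : seq I) (F : I -> M) :
  N (\sum_(i <- r) F i) <= \sum_(i <- r) N (F i).
Proof.
elim: r => [|i r IH]; first by rewrite !big_nil norm0.
by rewrite !big_cons; apply: le_trans (normD _ _) _; rewrite lerD2l.
Qed.

Lemma norm_sub_mod3 x y t : N x <= 1 -> N y <= 1 -> x - y = t *+ 3 -> N t < 1.
Proof.
move=> hx hy e; have := normB x y; rewrite e normMn; lra.
Qed.

Lemma norm_le_nat z : exists b, N z <= b.+1%:R.
Proof.
exists (Num.bound (N z)).
by apply/ltW/(lt_trans (archi_boundP (norm_ge0 z))); rewrite ltr_nat.
Qed.

Section Cube.
Hypothesis Nge1 : forall z, z != 0 -> 1 <= N z.

Section Face.
Variable L : M -> Prop.
Hypotheses (L0 : L 0) (LB : forall x y, L x -> L y -> L (x - y)).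
Hypothesis cover : forall z, L z ->
  exists s t, [/\ L s, L t, N s <= 1 & z = s + t *+ 3].

Let LN x : L x -> L (- x). Proof. by move=> h; rewrite -sub0r; apply: LB. Qed.
Let LD x y : L x -> L y -> L (x + y).
Proof. by move=> hx hy; rewrite -[y]opprK; apply: LB => //; apply: LN. Qed.
Let LMn x k : L x -> L (x *+ k).
Proof. by move=> hx; elim: k => [|k IH]; rewrite ?mulr0n ?mulrS //; apply: LD. Qed.

(* The norm is additive on [F] exactly when [F] lies on a common face of the
   unit ball. *)
Definition coface (F : seq M) :=
  [/\ uniq F, forall x, x \in F -> L x /\ N x <= 1
    & N (\sum_(x <- F) x) = (size F)%:R].

(* The linear functional equal to [1] on the face of [F], as a relation on the
   span of [F]; [weight_inj] shows that it is well defined. *)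
Definition weight (F : seq M) (z : M) (k : int) :=
  exists a : M -> int, z = \sum_(x <- F) x *~ a x /\ k = \sum_(x <- F) a x.

Lemma weightB F z k z' k' :
  weight F z k -> weight F z' k' -> weight F (z - z') (k - k').
Proof.
move=> [a [-> ->]] [a' [-> ->]]; exists (fun x => a x - a' x).
rewrite -!sumrB; split=> //; by apply: eq_bigr => x _; rewrite mulrzBr.
Qed.

Lemma weight0 F : weight F 0 0.
Proof. by exists (fun=> 0); rewrite !big1. Qed.

Lemma weightN F z k : weight F z k -> weight F (- z) (- k).
Proof. by move=> h; rewrite -(sub0r z) -(sub0r k); apply: weightB => //; apply: weight0. Qed.

Lemma weightD F z k z' k' :
  weight F z k -> weight F z' k' -> weight F (z + z') (k + k').
Proof. by move=> h h'; rewrite -[z']opprK -[k']opprK; apply/weightB/weightN. Qed.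

Lemma weightMz F z k j : weight F z k -> weight F (z *~ j) (k * j).
Proof.
move=> [a [-> ->]]; exists (fun x => a x * j); rewrite mulr_suml; split=> //.
by rewrite mulrz_suml; apply: eq_bigr => x _; rewrite mulrzA.
Qed.

Lemma weight1 F x : uniq F -> x \in F -> weight F x 1.
Proof.
move=> uF xF; exists (fun y => (y == x)%:R : int); split.
  rewrite (bigD1_seq x) //= eqxx big1 ?addr0 // => y /negPf ->; exact: mulr0z.
by rewrite (bigD1_seq x) //= eqxx big1 ?addr0 // => y /negPf ->.
Qed.

(** Adding a large [B] to all coefficients of a relation makes them nonnegative. The triangle
    inequality then reads [B |F| <= B |F| + k], so [k >= 0]; the negated relation gives [k <= 0]. *)
Lemma weight_inj0 F k : coface F -> weight F 0 k -> k = 0.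
Proof.
move=> [uF FL NF] h.
suff H j : weight F 0 j -> 0 <= j.
  by apply/eqP; rewrite eq_le H // -oppr_ge0 H // -(oppr0 M); apply: weightN.
move=> [a [e ->]].
pose B := \sum_(x <- F) `|a x|%N.
have aB x : x \in F -> 0 <= B%:Z + a x.
  move=> xF; have : (`|a x| <= B)%N by rewrite /B (big_rem x) //= leq_addr.
  lia.
have : N ((\sum_(x <- F) x) *+ B) <= \sum_(x <- F) (B%:Z + a x)%:~R.
  have -> : (\sum_(x <- F) x) *+ B = \sum_(x <- F) x *~ (B%:Z + a x).
    under [RHS]eq_bigr => x _ do rewrite mulrzDr.
    by rewrite big_split /= -e addr0 -sumrMnl.
  apply: le_trans (norm_sum _ _) _.
  rewrite big_seq [leRHS]big_seq; apply: ler_sum => x xF.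
  rewrite normMz ger0_norm ?aB // ler_piMr ?ler0z ?aB //; by case: (FL x xF).
rewrite normMn NF -(rmorph_sum (intr : int -> R)) /= big_split /=.
rewrite big_const_seq iter_addr_0 count_predT.
by rewrite -natrM pmulrn ler_int -mulr_natr natz PoszM lerDl.
Qed.

Lemma weight_inj F z k k' : coface F -> weight F z k -> weight F z k' -> k = k'.
Proof.
move=> cF h h'; apply/eqP; rewrite -subr_eq0; apply/eqP; apply: weight_inj0 cF _.
by rewrite -(subrr z); apply: weightB.
Qed.

(* The leading digit [v] of the balanced ternary expansion of [b]. *)
Lemma ternary_leading r b : L b -> N b <= (3 ^+ r + 1) / 2 ->
  exists v d, [/\ L v, N v <= 1, L d, b = v *+ (3 ^ r) + d & N d <= (3 ^+ r - 1) / 2].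
Proof.
elim: r b => [|r IH] b Lb; rewrite ?expr0 ?exprS => hb.
  by exists b, 0; rewrite addr0 norm0 subrr mul0r; split=> //; lra.
have [s [t [Ls Lt Ns e]]] := cover Lb.
(* The shape of the bound survives division by 3: [((3^(r+1) + 1) / 2 + 1) / 3 = (3^r + 1) / 2]. *)
have ht : N t <= (3 ^+ r + 1) / 2.
  have := normB b s; rewrite {1}e addrC addKr normMn; lra.
have [v [d [Lv Nv Ld et hd]]] := IH _ Lt ht.
exists v, (s + d *+ 3); split=> //; first by apply: LD => //; apply: LMn.
  by rewrite e et mulrnDl -mulrnA expnSr addrCA.
by have := normD s (d *+ 3); rewrite normMn; lra.
Qed.


(** A coface is a duplicate-free part of the finite list [S], so enlarging [[:: s0]] must stop; [k]
    bounds the remaining steps. *)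
Lemma coface_max (S : seq M) s0 : (forall z, N z <= 1 -> z \in S) ->
  L s0 -> N s0 <= 1 -> s0 != 0 ->
  exists F, [/\ coface F, F != [::] &
     forall x, L x -> N x <= 1 -> coface (x :: F) -> False].
Proof.
move=> SP Ls Ns s0n.
suff H k F : coface F -> F != [::] -> (size S < size F + k)%N ->
    exists F, [/\ coface F, F != [::] &
     forall x, L x -> N x <= 1 -> coface (x :: F) -> False].
  apply: (H (size S) [:: s0]) => //.
  split=> //; first by move=> x; rewrite inE => /eqP ->.
  by rewrite big_seq1; apply/eqP; rewrite eq_le Ns Nge1.
elim: k F => [|k IH] F cF F0 hF.
  case: cF => uF FS _; move: hF; rewrite addn0 ltnNge uniq_leq_size // => x xF.
  by apply: SP; case: (FS x xF).
have [[x [Lx Nx cx]]|nx] := pselect (exists x, [/\ L x, N x <= 1 & coface (x :: F)]).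
  by apply: (IH (x :: F)) => //=; rewrite addSnnS.
by exists F; split=> // x Lx Nx cx; apply: nx; exists x.
Qed.

Lemma coface_extend F x : coface F -> (size F)%:R + 1 <= N (\sum_(y <- F) y + x) ->
  L x -> N x <= 1 -> x \notin F -> coface (x :: F).
Proof.
move=> [uF FL NF] h Lx Nx xF; split; first by rewrite /= xF.
  by move=> y; rewrite inE => /orP[/eqP ->|/FL].
apply/eqP; rewrite big_cons addrC eq_le -natr1 h andbT.
by apply: le_trans (normD _ _) _; rewrite NF lerD2l.
Qed.

(* [v] is the leading ternary digit of a point [b] in the relative interior of
   the cone over [F] with [N b = (3^r + 1) / 2]; this norm is the one that forces
   equality in the triangle inequality, so every face through [v] contains [b]
   and hence [F]. *)
Lemma smooth_direction F : coface F -> F != [::] ->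
  (forall x, L x -> N x <= 1 -> coface (x :: F) -> False) ->
  exists2 v, v \in F & forall x, L x -> N x <= 1 -> 2 <= N (v + x) -> x \in F.
Proof.
move=> cF F0 Fmax; have [uF FL NF] := cF.
case: F F0 Fmax cF uF FL NF => // h F' _ Fmax cF uF FL NF.
set F := h :: F' in Fmax cF uF FL NF *.
have [r hr] : exists r, (2 * size F <= 3 ^ r + 1)%N.
  by exists (2 * size F)%N; apply: leq_trans (ltnW (ltn_expl _ _)) (leq_addr _ _).
(* [c] extra copies of [h] bring the norm of [b] to exactly [(3^r + 1) / 2], an integer because
   [3^r] is odd. *)
pose c := ((3 ^ r + 1) %/ 2 - size F)%N.
have hc : (2 * (size F + c) = 3 ^ r + 1)%N.
  have o : odd (3 ^ r) by rewrite oddX orbT.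
  rewrite /c; lia.
have hcR : ((size F)%:R + c%:R : R) = (3 ^+ r + 1) / 2.
  by have := congr1 (fun k : nat => k%:R : R) hc; rewrite natrM !natrD natrX; lra.
pose b := \sum_(x <- F) x + h *+ c.
have hF : h \in F by rewrite mem_head.
have [Lh Nh] := FL h hF.
have Lsum : L (\sum_(x <- F) x).
  by rewrite big_seq; apply: (big_ind L) => // x /FL[].
have Lb : L b by apply: LD => //; apply: LMn.
(* Adding [c] times the sum of [F] without [h] to [b] gives [c + 1] times the sum of [F], of norm
   [(c + 1) |F|]; the added term has norm at most [c (|F| - 1)]. *)
have Nb : (size F)%:R + c%:R <= N b.
  have hs : N (\sum_(x <- F) x - h) <= (size F)%:R - 1.
    rewrite big_cons addrC addKr /= -natr1 addrK.
    apply: le_trans (norm_sum _ _) _.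
    have -> : (size F')%:R = \sum_(x <- F') (1 : R).
      by rewrite big_const_seq iter_addr_0 count_predT.
    rewrite big_seq [leRHS]big_seq; apply: ler_sum => x xF.
    by have [] := FL x; rewrite ?inE ?xF ?orbT.
  have := normD b ((\sum_(x <- F) x - h) *+ c).
  have -> : b + (\sum_(x <- F) x - h) *+ c = (\sum_(x <- F) x) *+ c.+1.
    by rewrite /b mulrnBl addrACA subrr addr0 mulrS.
  rewrite !normMn NF -natr1.
  have := ler_wpM2l (ler0n R c) hs; nra.
have Nb' : N b <= (3 ^+ r + 1) / 2.
  apply: le_trans (normD _ _) _; rewrite NF normMn -hcR lerD2l ler_piMr //.
have [v [d [Lv Nv Ld e Nd]]] := ternary_leading Lb Nb'.
have key x : L x -> N x <= 1 -> 2 <= N (v + x) -> x \in F.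
  move=> Lx Nx h2; apply/negPn/negP => xF; apply: (Fmax x) => //.
  apply: coface_extend => //.
  (* The left side has norm at least [2 3^r]. All terms but the first on the right contribute at
     most [c + (3^r - 1) / 2 + (3^r - 1)], which leaves at least [|F| + 1] for the first. *)
  have E : (v + x) *+ 3 ^ r = (\sum_(x <- F) x + x) + (h *+ c + (- d + x *+ (3 ^ r).-1)).
    have -> : (v + x) *+ 3 ^ r = (b - d) + (x + x *+ (3 ^ r).-1).
      by rewrite mulrnDl e addrK -mulrS prednK // expn_gt0.
    by rewrite [RHS]addrACA (addrCA x) addrA.
  have := normMn (v + x) (3 ^ r); rewrite E => E'.
  have p3 : (1 : R) <= 3 ^+ r by apply: exprn_ege1; lra.
  have p : ((3 ^ r).-1%:R : R) = 3 ^+ r - 1.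
    by rewrite -subn1 natrB ?expn_gt0 // natrX.
  have h1 := normD (\sum_(x <- F) x + x) (h *+ c + (- d + x *+ (3 ^ r).-1)).
  have h3 := normD (h *+ c) (- d + x *+ (3 ^ r).-1).
  have h4 := normD (- d) (x *+ (3 ^ r).-1).
  rewrite E' natrX in h1; rewrite !normMn p in h3 h4; rewrite normN in h4.
  have g1 : (3 ^+ r - 1) * N x <= 3 ^+ r - 1 by rewrite ler_piMr // subr_ge0.
  have g2 : c%:R * N h <= c%:R by rewrite ler_piMr.
  have g3 : 3 ^+ r * 2 <= 3 ^+ r * N (v + x) by rewrite ler_wpM2l // exprn_ge0.
  lra.
(* [key] applies to [v] itself because [N (2 v) >= 2] for [v] nonzero; [v = 0] would make [b = d]
   too short. *)
exists v => //; apply: key => //.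
have v0 : v != 0.
  apply/negP => /eqP v0; move: e Nb; rewrite v0 mul0rn add0r => ->; lra.
by rewrite -mulr2n normMn; have := Nge1 v0; lra.
Qed.

(** Write [x + v = s + 3 t]. A nonzero [t] would give [N (x + v) >= 3 - 1 = 2], and hence [x] in
    [F]; so [x + v] is the small point [s]. *)
Lemma norm_add_direction (F : seq M) v x : L v ->
  (forall x, L x -> N x <= 1 -> 2 <= N (v + x) -> x \in F) ->
  L x -> N x <= 1 -> x \notin F -> N (x + v) <= 1.
Proof.
move=> Lv key Lx Nx xF; have [s [t [Ls Lt Ns e]]] := cover (LD Lx Lv).
have [t0|tn] := eqVneq t 0; first by rewrite e t0 mul0rn addr0.
case/negP: xF; apply: key => //; rewrite addrC.
have e' : x + v - s = t *+ 3 by rewrite e addrC addKr.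
have := normB (x + v) s; rewrite e' normMn.
have := Nge1 tn; lra.
Qed.

(** If none of [s], [- s], [s + v] lay in [F], then [s + 2 v] and [s - v] would both be in the unit
    ball and [v], a third of their difference, would have norm below 1. So points of the ball have
    weight -1, 0 or 1, and expansion in base 3 carries the weight to all of [L]. *)
Lemma weight_total F v z : coface F -> v \in F ->
  (forall x, L x -> N x <= 1 -> 2 <= N (v + x) -> x \in F) ->
  L z -> exists2 k, weight F z k & (N z <= 1 -> `|k| <= 1).
Proof.
move=> cF vF key; have [uF FL NF] := cF; have [Lv Nv] := FL v vF.
have wv : weight F v 1 by apply: weight1.
have step x : L x -> N x <= 1 -> x \notin F -> N (x + v) <= 1.
  exact: norm_add_direction.
have v0 : v != 0.
  apply/negP => /eqP e0; have := weight_inj cF wv (k' := 0); rewrite e0.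
  by move/(_ (weight0 F)).
have small s : L s -> N s <= 1 -> exists2 k, weight F s k & `|k| <= 1.
  move=> Ls Ns; case: (boolP (s \in F)) => [sF|sF].
    by exists 1; first exact: weight1.
  case: (boolP (- s \in F)) => [sF'|sF'].
    by exists (- 1) => //; rewrite -[s]opprK; apply/weightN/weight1.
  have Np : N (s + v) <= 1 by apply: step.
  have Nm : N (- s + v) <= 1 by apply: step; rewrite ?normN //; apply: LN.
  case: (boolP (s + v \in F)) => [sv|sv].
    by exists 0 => //; rewrite -(addrK v s) -[0](subrr 1); apply: weightB => //; apply: weight1.
  have N2 : N (s + v + v) <= 1 by apply: step => //; apply: LD.
  have Nm' : N (s - v) <= 1 by rewrite -normN opprB addrC.
  have e3 : s + v + v - (s - v) = v *+ 3.
    by rewrite -(addrA s v v) opprB [LHS]addrC addrA subrK -mulr2n -mulrS.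
  by have := norm_sub_mod3 N2 Nm' e3; rewrite ltNge Nge1.
move=> Lz.
have [Nz|Nz] := leP (N z) 1; first by have [k] := small z Lz Nz; exists k.
suff [k wk] : exists k, weight F z k by exists k.
have [b] := norm_le_nat z.
elim: b z Lz {Nz} => [|b IH] z Lz hb.
  by have [k] := small z Lz hb; exists k.
have [s [t [Ls Lt Ns e]]] := cover Lz.
have [k wk _] := small s Ls Ns.
have [|j wj] := IH t Lt.
  have := normB z s; rewrite {1}e addrC addKr normMn.
  move: hb; rewrite -![_.+1%:R]natr1; have := ler0n R b; lra.
exists (k + j + j + j); rewrite e !mulrS mulr0n addr0 !addrA.
by do !apply: weightD.
Qed.
End Face.

(** Families are indexed by [nat], and only the first [k] entries count, so that prepending a vector
    needs no cast between index types. *)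
Definition lin_comb k (e : nat -> M) (c : nat -> int) := \sum_(i < k) e i *~ c i.

Definition indep k (e : nat -> M) :=
  forall c, lin_comb k e c = 0 -> forall i, (i < k)%N -> c i = 0.

Lemma subgroupMz (L : M -> Prop) x (k : int) :
  L 0 -> (forall x y, L x -> L y -> L (x - y)) -> L x -> L (x *~ k).
Proof.
move=> L0 LB Lx; have LN y : L y -> L (- y) by move=> h; rewrite -sub0r; apply: LB.
have P j : L (x *+ j).
  by elim: j => [|j IHj] //; rewrite mulrSr -[X in _ + X]opprK; apply: LB => //; apply: LN.
by case: k => j; [apply: P | rewrite NegzE mulrNz; apply/LN/P].
Qed.

Lemma lin_comb_closed (L : M -> Prop) k e c :
  L 0 -> (forall x y, L x -> L y -> L (x - y)) ->
  (forall i, (i < k)%N -> L (e i)) -> L (lin_comb k e c).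
Proof.
move=> L0 LB Le; apply: (big_ind L) => // [x y Lx Ly|i _].
  by rewrite -[y]opprK; apply: (LB) => //; rewrite -sub0r; apply: LB.
by apply: subgroupMz => //; apply: Le.
Qed.

(** Induction on the number of points of [L] in the unit ball: the subgroup [L'] of weight 0 loses
    [v] and inherits the covering property, and [v] is put in front of its basis. *)
Lemma cube_basis (S : seq M) (L : M -> Prop) :
  (forall z, N z <= 1 -> z \in S) ->
  L 0 -> (forall x y, L x -> L y -> L (x - y)) ->
  (forall z, L z -> exists s t, [/\ L s, L t, N s <= 1 & z = s + t *+ 3]) ->
  exists k e,
    [/\ forall i, (i < k)%N -> L (e i),
        forall z, L z -> exists c, z = lin_comb k e c,
        forall c, (forall i, (i < k)%N -> `|c i| <= 1) -> N (lin_comb k e c) <= 1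
      & indep k e].
Proof.
move=> SP.
pose T (P : M -> Prop) := [seq x <- undup S | `[< P x /\ N x <= 1 >]].
have memT P x : (x \in T P) = `[< P x /\ N x <= 1 >].
  rewrite mem_filter mem_undup; case: asboolP => //= -[_ /SP]; done.
have [m] := ubnP (size (T L)).
elim: m L => // m IH L hm L0 LB cover.
have [[s0 [Ls0 Ns0 s0n]]|triv] := pselect (exists s, [/\ L s, N s <= 1 & s != 0]); last first.
  exists 0, (fun=> 0); split=> // [z Lz|c _]; last by rewrite /lin_comb big_ord0 norm0.
  exists (fun=> 0); rewrite /lin_comb big_ord0.
  (* With 0 as the only point of the ball, every [z] is of the form [3 t], and induction on a bound
     for the norm gives [z = 0]. *)
  have [b] := norm_le_nat z.
  have sm s : L s -> N s <= 1 -> s = 0.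
    by move=> Ls Ns; apply/eqP/negPn/negP => sn; apply: triv; exists s.
  elim: b z Lz => [|b IHb] z Lz hb; first exact: sm.
  have [s [t [Ls Lt Ns e]]] := cover _ Lz.
  rewrite e (sm s) // (IHb t) ?add0r ?mul0rn //.
  have := normB z s; rewrite {1}e addrC addKr normMn.
  move: hb; rewrite -![_.+1%:R]natr1; have := ler0n R b; lra.
have [F [cF F0 Fmax]] := coface_max SP Ls0 Ns0 s0n.
have [v vF key] := smooth_direction L0 LB cover cF F0 Fmax.
have [uF FL NF] := cF; have [Lv Nv] := FL v vF.
have tot := weight_total L0 LB cover cF vF key.
have wv := weight1 uF vF.
pose L' z := L z /\ weight F z 0.
have L'0 : L' 0 by split=> //; apply: weight0.
have L'B x y : L' x -> L' y -> L' (x - y).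
  by move=> [Lx wx] [Ly wy]; split; [apply: LB | rewrite -(subrr 0); apply: weightB].
have [| |k [e [e1 e2 e3 e4]]] := IH L' _ L'0 L'B.
- rewrite ltnS in hm; apply: leq_trans hm; rewrite -[(size _).+1]/(size (v :: T L')).
  apply: uniq_leq_size.
    rewrite /= filter_uniq ?undup_uniq // andbT memT.
    by apply/asboolP => -[[_ /(weight_inj cF wv)]].
  move=> x; rewrite inE !memT => /orP[/eqP ->|/asboolP[[Lx _] Nx]]; exact/asboolP.
- move=> z [Lz wz]; have [s [t [Ls Lt Ns es]]] := cover z Lz.
  have [j wj /(_ Ns) hj] := tot s Ls; have [i wi _] := tot t Lt.
  (* Since [|j| <= 1], this forces both digits of [z] to have weight 0, which is the covering
     property of [L']. *)
  have E : 0 = j + i * 3.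
    by apply: weight_inj cF wz _; rewrite es pmulrn; apply: weightD => //; apply: weightMz.
  have j0 : j = 0 by lia.
  have i0 : i = 0 by lia.
  by subst i j; exists s, t.
exists k.+1, (fun i => if i is j.+1 then e j else v).
have split_comb c : lin_comb k.+1 (fun i => if i is j.+1 then e j else v) c =
    v *~ c 0%N + lin_comb k e (fun i => c i.+1).
  by rewrite /lin_comb big_ord_recl.
have L'c c : L' (lin_comb k e c) by apply: lin_comb_closed.
have wv' c : weight F (v *~ c) c by rewrite -[c in weight _ _ c]mul1r; apply: weightMz.
split.
- by move=> [|i] //=; rewrite ltnS => /e1[].
- move=> z Lz; have [j wj _] := tot z Lz.
  have [|c ec] := e2 (z - v *~ j).
    split; last by rewrite -(subrr j); apply: weightB.
    by apply: (LB) => //; apply: subgroupMz.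
  exists (fun i => if i is i'.+1 then c i' else j).
  by rewrite split_comb -ec addrC subrK.
- move=> c hc; rewrite split_comb.
  set y := lin_comb _ _ _; have [Ly wy] : L' y by apply: L'c.
  have Ny : N y <= 1 by apply: e3 => i hi; apply: hc.
  (* Weight 0 keeps [y] and [- y] out of [F], whose points have weight 1, so [v] may be added to
     either without leaving the ball. *)
  have yF : y \notin F.
    by apply/negP => yF; have := weight_inj cF wy (weight1 uF yF).
  have yF' : - y \notin F.
    by apply/negP => yF'; have := weight_inj cF (weightN wy) (weight1 uF yF').
  have := hc 0%N isT.
  have -> : (`|c 0%N| <= 1) = [|| c 0%N == 0, c 0%N == 1 | c 0%N == -1] by lia.
  case/or3P => /eqP ->.
  + by rewrite mulr0z add0r.
  + by rewrite mulr1z addrC; apply: (norm_add_direction L0 LB cover Lv key).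
  + rewrite mulrN1z -normN opprD opprK addrC.
    by apply: (norm_add_direction L0 LB cover Lv key) => //; rewrite ?normN // -sub0r; apply: LB.
- move=> c; rewrite split_comb => c0.
  have [_ wc] := L'c (fun i => c i.+1).
  have c00 : c 0%N = 0.
    have w : weight F 0 (c 0%N + 0) by rewrite -c0; apply: weightD.
    by rewrite -[LHS]addr0; apply: weight_inj0 cF w.
  move: c0; rewrite c00 mulr0z add0r => c0 [|i] //.
  by rewrite ltnS; apply: (e4 (fun i => c i.+1)).
Qed.

End Cube.
End Norm.

(** * Classes modulo 3 Z^n + Z v *)

Lemma sum_count_le (T : Type) (U : eqType) (f : T -> U) (s : seq T) (us : seq U) :
  uniq us -> (\sum_(u <- us) count (fun x => f x == u) s <= size s)%N.
Proof.
move=> uus; elim: s => [|x s IH]; first by rewrite big1.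
rewrite /= big_split /= -add1n leq_add //.
elim: us uus {IH} => [|u us IH] /=; first by rewrite big_nil.
rewrite big_cons => /andP[uu /IH h]; have [e|//] := eqVneq (f x) u.
rewrite big_seq big1 // => w wus; apply/eqP; rewrite eqb0 e.
by apply: contraNneq uu => ->.
Qed.

Lemma sum_count_undup (T : Type) (U : eqType) (f : T -> U) (s : seq T) :
  (\sum_(u <- undup (map f s)) count (fun x => f x == u) s)%N = size s.
Proof.
have : {subset map f s <= undup (map f s)} by move=> u; rewrite mem_undup.
have := undup_uniq (map f s).
move: (undup _) => us uus.
elim: s => [|x s IH] sub /=; first by rewrite big1.
rewrite big_split /= IH; last by move=> u us'; apply: sub; rewrite inE us' orbT.
rewrite (bigD1_seq (f x)) ?sub ?mem_head //= eqxx big1 ?addn0 ?add1n //.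
by move=> u /negPf; rewrite eq_sym => ->.
Qed.

Lemma uniq_int_range (s : seq int) : uniq s -> s != [::] ->
  exists a b : int, [/\ a \in s, b \in s & (size s)%:Z <= b - a + 1].
Proof.
move=> us s0.
have [a [b [aS bS ab]]] :
    exists a b : int, [/\ a \in s, b \in s & forall x, x \in s -> a <= x <= b].
  elim: s s0 {us} => // x [|y s] IH _.
    by exists x, x; split; rewrite ?mem_head // => z; rewrite inE => /eqP ->; rewrite lexx.
  have [//|a [b [aS bS ab]]] := IH.
  exists (if x <= a then x else a), (if b <= x then x else b); split.
  - by case: ifP; rewrite inE ?eqxx ?aS ?orbT.
  - by case: ifP; rewrite inE ?eqxx ?bS ?orbT.
  move=> z; rewrite inE => /orP[/eqP ->|/ab]; have := ab b bS; do 2 case: ifP; lia.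
exists a, b; split=> //.
have hab := ab b bS.
have : (size s <= size [seq (a + i%:Z)%R | i <- iota 0 `|(b - a + 1)%R|%N])%N.
  apply: uniq_leq_size => // x /ab hx; apply/mapP; exists `|x - a|%N.
    rewrite mem_iota; lia.
  lia.
rewrite size_map size_iota; lia.
Qed.

(** Here [c] is the size of any segment of a class, [P] that of the longest one and [e] that of one
    at an extreme height. The quotients bound from below the interior points found at a third of the
    two height differences. *)
Lemma third_sum_bound (m c P e : nat) :
  (0 < m -> 0 < c -> c <= P -> P <= 2 * m + 3 -> 0 < e ->
  let F := (c + P + 2 * m - 1) %/ 3 + (c + e + 2 * m - 1) %/ 3 in
  c <= F /\ (P = 2 * m + 3 -> F <= c -> c = 2 * m + 3 /\ e < 2 * m + 3))%N.
Proof. move=> m0 c0 cP Pm e0 F; rewrite /F; split; lia. Qed.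

(** Differences [s - q] are at most [s - a], whereas differences [q - a] with [q > s] exceed it, so
    the two kinds never collide. The next lemma is the mirror image. *)
Lemma chain_inj_low (s a q q' : int) :
  a <= q -> a <= q' -> a <= s -> q != s -> q' != s ->
  (if q < s then s else q) - (if q < s then q else a) =
  (if q' < s then s else q') - (if q' < s then q' else a) -> q = q'.
Proof. do 2 case: ifP; lia. Qed.

Lemma chain_inj_high (s b q q' : int) :
  q <= b -> q' <= b -> s <= b -> q != s -> q' != s ->
  (if q < s then b else q) - (if q < s then q else s) =
  (if q' < s then b else q') - (if q' < s then q' else s) -> q = q'.
Proof. do 2 case: ifP; lia. Qed.

(** * The bound for a single class *)

Section Lines.
Variables (R : archiRealFieldType) (M : zmodType) (N : M -> R).
Hypothesis Nn : group_norm N.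
Variables (v : M) (m : nat).
Hypotheses (Nm : N (v *+ m) < 1) (Nm1 : 1 <= N (v *+ m.+1)).

Lemma direction_norm_gt0 : 0 < N v.
Proof.
move: Nm1; rewrite (normMn Nn); have := norm_ge0 Nn v.
by rewrite le_eqVlt => /orP[/eqP <-|//]; rewrite mulr0 ler10.
Qed.

Lemma direction_inj (j k : int) : v *~ j = v *~ k -> j = k.
Proof.
move=> e; apply/eqP; rewrite -subr_eq0; apply/eqP.
have := normMz Nn v (j - k); rewrite mulrzBr e subrr (norm0 Nn).
move/eqP; rewrite eq_sym mulf_eq0 (gt_eqF direction_norm_gt0) orbF.
rewrite intr_eq0; lia.
Qed.

Lemma norm_direction_lt1 (k : int) : `|k| <= m -> N (v *~ k) < 1.
Proof.
move=> hk; apply: le_lt_trans Nm; rewrite (normMz Nn) (normMn Nn).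
by rewrite ler_wpM2r ?(norm_ge0 Nn) // pmulrn ler_int.
Qed.

(** Convexity of [N] along a line, with the denominator [b - a] cleared. *)
Lemma norm_between (x : M) (a b c : int) : a <= c <= b ->
  N (x + v *~ a) <= 1 -> N (x + v *~ b) <= 1 -> N (x + v *~ c) <= 1.
Proof.
move=> /andP[ac cb] Na Nb; have [e|ne] := eqVneq a b.
  by have -> : c = a by lia.
have hR : (0 : R) < (b - a)%:~R by rewrite ltr0z; lia.
rewrite -(ler_pM2l hR) mulr1.
have := normMz Nn (x + v *~ c) (b - a); rewrite ger0_norm; last by lia.
move=> <-.
have -> : (x + v *~ c) *~ (b - a) = (x + v *~ a) *~ (b - c) + (x + v *~ b) *~ (c - a).
  rewrite !mulrzDl addrACA -!mulrzA -!mulrzDr; congr (x *~ _ + v *~ _); ring.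
apply: le_trans (normD Nn _ _) _; rewrite !(normMz Nn).
have -> : (b - a)%:~R = `|b - c|%:~R + `|c - a|%:~R :> R.
  by rewrite -intrD; congr (_%:~R); lia.
by apply: lerD; rewrite ler_piMr // ler0z; lia.
Qed.

Definition run (y : M) (p : nat) := forall i, (i < p)%N -> N (y + v *+ i) <= 1.

(** The ends of [2m + 4] consecutive points differ by [(2m + 3) v], of norm
    [2 (m + 1) N v + N v > 2], too long for two points of the ball. *)
Lemma run_size y p : run y p -> (p <= 2 * m + 3)%N.
Proof.
move=> ry; rewrite leqNgt; apply/negP => hp.
have h0 : N (y + v *+ 0) <= 1 by apply: ry; lia.
have h1 : N (y + v *+ (2 * m + 3)) <= 1 by apply: ry; lia.
have := normB Nn (y + v *+ (2 * m + 3)) (y + v *+ 0).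
rewrite opprD addrACA subrr add0r mulr0n subr0 (normMn Nn).
have e : (2 * m + 3)%:R = 2 * m.+1%:R + 1 :> R.
  by rewrite -natrM natr1; congr (_%:R); lia.
have := Nm1; rewrite (normMn Nn) e => h2; have := direction_norm_gt0.
move: h0 h1; rewrite mulr0n addr0; lra.
Qed.

(** Convexity fills the gaps between the extreme points of [L], so the run can start at the lowest
    one. *)
Lemma line_run (L : seq M) : uniq L -> L != [::] ->
  (forall x, x \in L -> N x <= 1) ->
  (forall x y, x \in L -> y \in L -> exists c, x - y = v *~ c) ->
  exists2 y, y \in L & run y (size L).
Proof.
case: L => // x0 L' uL _; set L := x0 :: L' in uL *; move=> NL Lv.
have [cs ecs] : exists cs, L = [seq x0 + v *~ c | c <- cs].
  have : forall x, x \in L -> exists c, x - x0 = v *~ c.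
    by move=> x xL; apply: Lv => //; apply: mem_head.
  elim: {uL NL Lv}L => [|x L IH] hL; first by exists [::].
  have [|cs ->] := IH; first by move=> y yL; apply: hL; rewrite inE yL orbT.
  have [c ec] := hL x (mem_head _ _).
  by exists (c :: cs); rewrite /= -ec addrC subrK.
have ucs : uniq cs by move: uL; rewrite ecs => /map_uniq.
have [|a [b [acs bcs hab]]] := uniq_int_range ucs; first by case: cs ecs {ucs}.
have memL c : c \in cs -> x0 + v *~ c \in L by rewrite ecs; apply: map_f.
exists (x0 + v *~ a); first exact: memL.
move=> i; rewrite ecs size_map => hi.
rewrite -addrA pmulrn -mulrzDr; apply: (norm_between (a := a) (b := b)).
- lia.
- exact/NL/memL.
- exact/NL/memL.
Qed.

(** Every such [D] is [i - i' + k] with [i < p], [i' < p'] and [|k| <= m]; the three resulting terms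
    have norms at most 1, at most 1 and below 1. *)
Lemma run_diff y p y' p' (D : int) : run y p -> run y' p' ->
  - (p'%:Z - 1) - m%:Z <= D <= p%:Z - 1 + m%:Z -> (0 < p)%N -> (0 < p')%N ->
  N (y - y' + v *~ D) < 3.
Proof.
move=> ry ry' hD hp hp'.
have [i [i' [k [hi hi' hk ->]]]] : exists (i i' : nat) (k : int),
    [/\ (i < p)%N, (i' < p')%N, `|k| <= m & D = i%:Z - i'%:Z + k].
  have [D0|D0] := leP 0 D.
    have [Dp|Dp] := leP D (p%:Z - 1).
      exists `|D|%N, 0%N, 0; split; lia.
    exists p.-1, 0%N, (D - (p%:Z - 1)); split; lia.
  have [Dp|Dp] := leP (- D) (p'%:Z - 1).
    exists 0%N, `|D|%N, 0; split; lia.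
  exists 0%N, p'.-1, (D + (p'%:Z - 1)); split; lia.
have -> : y - y' + v *~ (i%:Z - i'%:Z + k) = (y + v *+ i) - (y' + v *+ i') + v *~ k.
  by rewrite !mulrzDr mulrNz -!pmulrn opprD [in RHS]addrACA !addrA.
have := normD Nn (y + v *+ i - (y' + v *+ i')) (v *~ k).
have := normB Nn (y + v *+ i) (y' + v *+ i').
have := norm_direction_lt1 hk; have := ry i hi; have := ry' i' hi'; lra.
Qed.

Variables (h : M -> int) (I : seq M).
Hypotheses (hB : forall x y, h (x - y) = h x - h y) (hv : h v = 0).
Hypothesis memI : forall z, N z < 1 -> z \in I.

Let h0 : h 0 = 0. Proof. by rewrite -(subrr 0) hB subrr. Qed.
Let hD x y : h (x + y) = h x + h y.
Proof. by rewrite -{1}[y]opprK hB -[- y]sub0r hB h0 sub0r opprK. Qed.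
Let hvz j : h (v *~ j) = 0.
Proof.
have P (k : nat) : h (v *+ k) = 0.
  by elim: k => [|k IH]; rewrite ?mulr0n ?mulrS ?hD ?IH ?hv ?addr0.
by case: j => k; rewrite -?pmulrn ?P // NegzE mulrNz -pmulrn -sub0r hB h0 P.
Qed.

(** The interior points at height [t / 3], with the division avoided. *)
Definition third_count (t : int) := count (fun z => h z *+ 3 == t) I.

Lemma progression_count w (j0 : int) (T : nat) t :
  (forall i, (i < T)%N -> N (w + v *~ (j0 + i%:Z)) < 1) -> h w *+ 3 = t ->
  (T <= third_count t)%N.
Proof.
move=> Hw hw; rewrite /third_count -size_filter -(size_iota 0 T).
rewrite -(size_map (fun i : nat => w + v *~ (j0 + i%:Z))); apply: uniq_leq_size.
  rewrite map_inj_uniq ?iota_uniq // => i k /addrI/direction_inj/addrI; lia.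
move=> z /mapP[i]; rewrite mem_iota => /andP[_ hi] ->.
by rewrite mem_filter memI ?Hw // hD hvz addr0 hw eqxx.
Qed.

Lemma third_count0 : (2 * m + 1 <= third_count 0)%N.
Proof.
apply: (progression_count (w := 0) (j0 := - m%:Z)); last by rewrite h0 mul0rn.
move=> i hi; rewrite add0r; apply: norm_direction_lt1; lia.
Qed.

(* A point [z] with [3 z = x - y + k v], [|k| <= m], has norm less than
   [(1 + 1 + 1) / 3]. *)
Lemma third_count_diff y p y' p' w (c : int) : run y p -> run y' p' ->
  (0 < p)%N -> (0 < p')%N -> y - y' = w *+ 3 + v *~ c ->
  ((p + p' + 2 * m - 1) %/ 3 <= third_count (h y - h y'))%N.
Proof.
move=> ry ry' hp hp' e.
pose lo : int := c - (p'%:Z - 1) - m%:Z.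
(* The start is [lo / 3] rounded up. The admissible values of [3 j] lie among [p + p' + 2m - 1]
   consecutive integers, at least a third of which, rounded down, are multiples of 3. *)
apply: (progression_count (w := w) (j0 := ((lo + 2) %/ 3)%Z)); last first.
  by rewrite -hB e hD hvz addr0 !mulrS mulr0n !hD h0.
move=> i hi; set j : int := ((lo + 2) %/ 3)%Z + i%:Z.
have hj : lo <= j * 3 <= c + (p%:Z - 1) + m%:Z by rewrite /j /lo; lia.
have := run_diff (D := j * 3 - c) ry ry'.
have -> : y - y' + v *~ (j * 3 - c) = (w + v *~ j) *+ 3.
  by rewrite e mulrzBr addrACA subrr addr0 mulrnDl [v *~ j *+ 3]pmulrn -mulrzA.
rewrite (normMn Nn) => H; have : 3%:R * N (w + v *~ j) < 3 by apply: H; lia.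
lra.
Qed.

Variable A : seq M.
Hypotheses (uA : uniq A) (NA : forall x, x \in A -> N x <= 1).
Hypothesis A3 : forall x y, x \in A -> y \in A ->
  exists w c, x - y = w *+ 3 + v *~ c.
Hypothesis Ah : forall x y, x \in A -> y \in A -> h x = h y ->
  exists c, x - y = v *~ c.
Hypothesis m0 : (0 < m)%N.

Let H := undup (map h A).
Let cnt (q : int) := count (fun x => h x == q) A.
Let T a b := ((a + b + 2 * m - 1) %/ 3)%N.

Lemma height_run q : q \in H ->
  exists y, [/\ y \in A, h y = q, run y (cnt q) & (0 < cnt q)%N].
Proof.
rewrite mem_undup => /mapP[x xA eq].
have xq : x \in [seq x <- A | h x == q] by rewrite mem_filter eq eqxx.
have [||||y y1 y2] := @line_run [seq x <- A | h x == q].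
- exact: filter_uniq.
- by apply/eqP => e; rewrite e in xq.
- by move=> z; rewrite mem_filter => /andP[_ /NA].
- move=> z z'; rewrite !mem_filter => /andP[/eqP e zA] /andP[/eqP e' z'A].
  by apply: Ah; rewrite ?e ?e'.
exists y; rewrite mem_filter in y1; case/andP: y1 => /eqP hy yA.
rewrite size_filter in y2; split=> //.
by rewrite /cnt -has_count; apply/hasP; exists y => //; apply/eqP.
Qed.

Lemma height_diff_count q q' : q \in H -> q' \in H ->
  (T (cnt q) (cnt q') <= third_count (q - q'))%N.
Proof.
move=> /height_run[y [yA <- ry cy]] /height_run[y' [y'A <- ry' cy']].
by have [w [c e]] := A3 yA y'A; apply: third_count_diff ry ry' cy cy' e.
Qed.

(** The values 0, [d q] and [- d q] are pairwise distinct, so the interior points counted at them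
    are disjoint; height 0 alone supplies [2m + 1]. *)
Lemma difference_chain qs (a b : int -> int) :
  (forall q, q \in H -> q != qs -> [/\ a q \in H, b q \in H & b q < a q]) ->
  {in [pred q | (q \in H) && (q != qs)] &, injective (fun q => a q - b q)} ->
  (2 * m + 1 + 2 * \sum_(q <- H | q != qs) T (cnt (a q)) (cnt (b q)) <= size I)%N.
Proof.
move=> ab dinj; pose H' := [seq q <- H | q != qs].
pose d q := a q - b q.
have H'P q : q \in H' -> [/\ a q \in H, b q \in H & b q < a q].
  by rewrite mem_filter => /andP[? ?]; apply: ab.
have uH' : uniq H' by rewrite filter_uniq // undup_uniq.
have udH : uniq (map d H').
  rewrite map_inj_in_uniq // => x y; rewrite !mem_filter ![_ && (_ \in _)]andbC => *.
  exact: dinj.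
pose ts := 0 :: (map d H' ++ map (fun q => - d q) H').
have uts : uniq ts.
  have uNdH : uniq (map (fun q => - d q) H').
    by rewrite (map_comp -%R) (map_inj_uniq oppr_inj).
  rewrite /= cat_uniq udH uNdH andbT mem_cat negb_or /=.
  apply/andP; split; first (apply/andP; split; apply/negP).
  - by case/mapP => q /H'P[_ _]; rewrite /d; lia.
  - by case/mapP => q /H'P[_ _]; rewrite /d; lia.
  apply/hasPn => t /mapP[q /H'P[_ _ hq] ->].
  by apply/negP => /mapP[q' /H'P[_ _]]; rewrite /d; lia.
apply: leq_trans (sum_count_le (fun z => h z *+ 3) I uts).
rewrite big_cons big_cat /= !big_map; apply: leq_add; first exact: third_count0.
rewrite mul2n -addnn -big_filter -/H' big_seq [X in (_ <= X + _)%N]big_seq.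
rewrite [X in (_ <= _ + X)%N]big_seq; apply: leq_add; apply: leq_sum => q /H'P[aq bq _].
  exact: height_diff_count.
rewrite /d opprB /T [(cnt (a q) + _)%N]addnC; exact: height_diff_count.
Qed.


(* With the longest segment at height [qs], both [qs - q] (for [q < qs]) and
   [q - qmin] (for [q > qs]) are distinct positive differences, and so are their
   mirror images [qmax - q] and [q - qs]; averaging the two counts beats the
   rounding losses in [third_sum_bound]. *)
Lemma class_bound :
  (size A <= size I + 2)%N /\
  ((size I + 2 <= size A)%N -> (size I <= 2 * m + 1)%N /\
    exists2 y, y \in A & run y (2 * m + 3)).
Proof.
have [A0|[x xA]] : A = [::] \/ exists x, x \in A.
  by case: (A) => [|x s]; [left | right; exists x; rewrite mem_head].
  by rewrite A0; split=> //=; rewrite addn2.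
have mH z : z \in A -> h z \in H by move=> zA; rewrite mem_undup map_f.
have cle q : q \in H -> (0 < cnt q <= 2 * m + 3)%N.
  by move=> /height_run[y [_ _ /run_size -> ->]].
have extremum (f : int -> int) : exists2 q, q \in H & forall q', q' \in H -> f q' <= f q.
  have Hn : H != [::] by apply/eqP => e; have := mH x xA; rewrite e.
  elim: (H) Hn => // q [|q' s] IH _.
    by exists q; rewrite ?mem_head // => q'; rewrite inE => /eqP ->.
  have [//|r rs hr] := IH.
  have [qr|qr] := leP (f q) (f r).
    exists r; first by rewrite inE rs orbT.
    by move=> z; rewrite inE => /orP[/eqP ->|/hr].
  exists q; first exact: mem_head.
  by move=> z; rewrite inE => /orP[/eqP ->|/hr] //; lia.
have [qs qsH hqs] := extremum (fun q => (cnt q)%:Z).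
have [qmax qmaxH hmax] := extremum id.
have [qmin qminH hmin] := extremum (fun q => - q).
pose e q := if (q < qs)%R then cnt qmax else cnt qmin.
have S1 := @difference_chain qs (fun q => if (q < qs)%R then qs else q)
                                (fun q => if (q < qs)%R then q else qmin).
have S2 := @difference_chain qs (fun q => if (q < qs)%R then qmax else q)
                                (fun q => if (q < qs)%R then q else qs).
pose F q := (T (cnt q) (cnt qs) + T (cnt q) (e q))%N.
(* The average of [S1] and [S2]: over both chains each [q] is paired once with [qs] and once with an
   extreme height, whose count is [e q]. *)
have Sum : (2 * m + 1 + \sum_(q <- H | q != qs) F q <= size I)%N.
  pose T1 (q : int) :=
    T (cnt (if (q < qs)%R then qs else q)) (cnt (if (q < qs)%R then q else qmin)).
  pose T2 (q : int) :=
    T (cnt (if (q < qs)%R then qmax else q)) (cnt (if (q < qs)%R then q else qs)).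
  suff : (2 * m + 1 + 2 * \sum_(q <- H | q != qs) T1 q <= size I)%N /\
         (2 * m + 1 + 2 * \sum_(q <- H | q != qs) T2 q <= size I)%N.
    move=> [h1 h2].
    suff -> : (\sum_(q <- H | q != qs) F q =
       \sum_(q <- H | q != qs) T1 q + \sum_(q <- H | q != qs) T2 q)%N.
      by move: h1 h2; do 2 move: (\sum_(q <- H | _) _)%N => ?; clear; lia.
    rewrite -big_split; apply: eq_bigr => q _; rewrite /F /e /T1 /T2 /T /=.
    case: ifP => _; last exact: addnC.
    by rewrite [(cnt qs + cnt q)%N]addnC [(cnt qmax + _)%N]addnC.
  split; [apply: S1 | apply: S2].
  - move=> q qH qn; have := hmin qs qsH; rewrite /= lerN2 => hq.
    have [|qsq] := ltP q qs; first by split.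
    by split=> //; apply: le_lt_trans hq _; rewrite lt_neqAle eq_sym qn.
  - move=> q q' /andP[qH qn] /andP[q'H qn'].
    by apply: chain_inj_low => //; rewrite -lerN2; apply: hmin.
  - move=> q qH qn; have hq := hmax qs qsH.
    have [lt|qsq] := ltP q qs; split=> //; first exact: lt_le_trans lt hq.
    by rewrite lt_neqAle eq_sym qn.
  - move=> q q' /andP[qH qn] /andP[q'H qn'].
    by apply: chain_inj_high => //; apply: hmax.
have FP q : q \in H -> (cnt q <= F q)%N /\
    (cnt qs = 2 * m + 3 -> F q <= cnt q -> cnt q = 2 * m + 3 /\ e q < 2 * m + 3)%N.
  move=> qH; apply: third_sum_bound => //.
  - by case/andP: (cle q qH).
  - by have := hqs q qH.
  - by case/andP: (cle qs qsH).
  - by rewrite /e; case: ifP => _; [case/andP: (cle _ qmaxH) | case/andP: (cle _ qminH)].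
have sA : size A = (cnt qs + \sum_(q <- H | q != qs) cnt q)%N.
  rewrite -(sum_count_undup h A) (bigD1_seq qs) ?undup_uniq //.
have Fge : (\sum_(q <- H | q != qs) cnt q <= \sum_(q <- H | q != qs) F q)%N.
  by rewrite big_seq_cond [leqRHS]big_seq_cond; apply: leq_sum => q /andP[/FP[]].
have Pqs := cle qs qsH.
split; first by lia.
move=> hge.
have P3 : (cnt qs = 2 * m + 3)%N by lia.
have Feq : (\sum_(q <- H | q != qs) F q <= \sum_(q <- H | q != qs) cnt q)%N by lia.
have Feach q : q \in H -> q != qs -> (F q <= cnt q)%N.
  move=> qH qn; move: Feq; rewrite -[X in (X <= _)%N]big_filter -[X in (_ <= X)%N]big_filter.
  rewrite !(bigD1_seq q) ?filter_uniq ?undup_uniq ?mem_filter ?qn ?qH //=.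
  move=> hF; rewrite -(leq_add2r (\sum_(i <- [seq i <- H | i != qs] | i != q) F i)).
  apply: leq_trans hF _; rewrite leq_add2l [leqLHS]big_seq_cond [leqRHS]big_seq_cond.
  apply: leq_sum => i; by rewrite mem_filter => /andP[/andP[_ /FP[]]].
have all_max q : q \in H -> cnt q = (2 * m + 3)%N.
  move=> qH; have [-> //|qn] := eqVneq q qs.
  by have [_ /(_ P3 (Feach q qH qn))[]] := FP q qH.
(* A second height would need an extreme segment shorter than [2m + 3], against [all_max]. *)
have H1 q : q \in H -> q = qs.
  move=> qH; apply/eqP/negPn/negP => qn.
  have [_ /(_ P3 (Feach q qH qn))[_]] := FP q qH.
  by rewrite /e; case: ifP; rewrite !all_max // ltnn.
have S0 : (\sum_(q <- H | q != qs) cnt q = 0)%N.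
  by rewrite big_seq_cond big1 // => q /andP[/H1 ->]; rewrite eqxx.
split; first lia.
by have [y [yA _ ry _]] := height_run qsH; exists y => //; rewrite -P3.
Qed.

End Lines.

(** * Residues modulo 3 and a generic functional *)

Lemma scalez (V : lmodType int) (c : int) (w : V) : c *: w = w *~ c.
Proof. by rewrite -scaler_int intz. Qed.

Definition mod3 n (x : 'rV[int]_n) : 'rV['F_3]_n := map_mx intr x.

Lemma F3_intr_eq0 (x : int) : (x%:~R : 'F_3) = 0 -> x = (x %/ 3)%Z * 3.
Proof.
move=> x0; rewrite {1}(divz_eq x 3).
have : 0 <= (x %% 3)%Z < 3 by lia.
move: x0; rewrite {1}(divz_eq x 3) rmorphD rmorphM /=.
have -> : (3%:~R : 'F_3) = 0 by apply: val_inj.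
rewrite mulr0 add0r; case: (x %% 3)%Z => // -[|[|[|r]]] //=; by rewrite addr0.
Qed.

Lemma mod3_eq0 n (x : 'rV[int]_n) : mod3 x = 0 -> exists t, x = t *+ 3.
Proof.
move=> x0; exists (\row_j divz (x 0 j) 3%Z); apply/rowP => j. 
rewrite mulmxnE mxE -mulr_natr; apply: F3_intr_eq0.
by move/rowP/(_ j): x0; rewrite !mxE.
Qed.

Lemma mod3B n (x y : 'rV[int]_n) : mod3 (x - y) = mod3 x - mod3 y.
Proof. by rewrite /mod3 raddfB. Qed.

Lemma mem_of_size (T : finType) (s : seq T) (x : T) : uniq s -> (#|T| <= size s)%N -> x \in s.
Proof.
move=> us hs; have sub : {subset s <= enum T} by move=> y _; rewrite mem_enum.
have [|_ ->] := uniq_min_size us sub; last by rewrite mem_enum.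
by rewrite -cardE.
Qed.

Lemma seq_argmin (R : realDomainType) (T : eqType) (f : T -> R) (s : seq T) : s != [::] ->
  exists2 x, x \in s & forall y, y \in s -> f x <= f y.
Proof.
elim: s => // x [|y s] IH _.
  by exists x; rewrite ?mem_head // => z; rewrite inE => /eqP ->.
have [//|z zs hz] := IH; have [xz|xz] := leP (f x) (f z).
  exists x; first exact: mem_head.
  by move=> w; rewrite inE => /orP[/eqP ->|/hz] //; apply: le_trans.
exists z; first by rewrite inE zs orbT.
by move=> w; rewrite inE => /orP[/eqP ->|/hz] //; apply: ltW.
Qed.

(** Evaluating the coordinate polynomial at [t] is linear in [z]. It suffices that [t] avoid the
    roots of the product of the finitely many nonzero polynomials. *)
Lemma separating_functional n (s : seq 'rV[int]_n) :
  exists t : int, forall z, z \in s -> (rVpoly z).[t] = 0 -> z = 0.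
Proof.
pose p : {poly int} := \prod_(z <- s | z != 0) rVpoly z.
have p0 : p != 0.
  rewrite prodf_seq_neq0; apply/allP => z _; apply/implyP => z0.
  by apply: contra_neq z0 => e; rewrite -(rVpolyK z) e linear0.
have [t ht] : exists t : int, p.[t] != 0.
  apply/not_existsP => H.
  have : all (root p) (map Posz (iota 0 (size p))).
    by apply/allP => x _; apply/negPn/negP => /H.
  have u : uniq (map Posz (iota 0 (size p))) by rewrite map_inj_uniq ?iota_uniq // => i j [].
  by move=> /(max_poly_roots p0) /(_ u); rewrite size_map size_iota ltnn.
exists t => z zs hz; apply/eqP/negPn/negP => z0; move: ht.
rewrite horner_prod prodf_seq_neq0 => /allP/(_ z zs); by rewrite z0 hz eqxx.
Qed.

Lemma sum_count_fin (T : Type) (U : finType) (f : T -> U) (s : seq T) :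
  (\sum_u count (fun x => f x == u) s)%N = size s.
Proof.
elim: s => [|x s IH] /=; first by rewrite big1.
rewrite big_split /= IH (bigD1 (f x)) //= eqxx big1 ?addn0 ?add1n // => u /negPf.
by rewrite eq_sym => ->.
Qed.

(** * Counting lattice points class by class *)

Section Bound.
Variables (R : archiRealFieldType) (n : nat) (N : 'rV[int]_n.+1 -> R).
Hypothesis Nn : group_norm N.
Hypothesis Ngt0 : forall z, z != 0 -> 0 < N z.
Variables SK SI : seq 'rV[int]_n.+1.
Hypotheses (uK : uniq SK) (memK : forall z, (z \in SK) = (N z <= 1)).
Hypothesis memI : forall z, (z \in SI) = (N z < 1).

Lemma card_mod3 k : #|{: 'rV['F_3]_k}| = (3 ^ k)%N.
Proof. by rewrite card_mx card_Fp // mul1n. Qed.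

(** Reduction modulo 3 is injective on [SK]; when the count is maximal it is also onto, which is the
    covering property. *)
Lemma only0_covering : (forall z, N z < 1 -> z = 0) ->
  (size SK <= 3 ^ n.+1)%N /\
  (size SK = (3 ^ n.+1)%N -> forall z, exists s t, N s <= 1 /\ z = s + t *+ 3).
Proof.
move=> only0.
have umod : uniq (map (@mod3 _) SK).
  rewrite map_inj_in_uniq // => x y; rewrite !memK => Nx Ny e.
  have [|t et] := @mod3_eq0 _ (x - y); first by rewrite mod3B e subrr.
  have := only0 t (norm_sub_mod3 Nn Nx Ny et) => t0.
  by apply/eqP; rewrite -subr_eq0 et t0 mul0rn.
split; first by rewrite -card_mod3 -(size_map (@mod3 _)) -(card_uniqP umod) max_card.
move=> sz z.
have : mod3 z \in map (@mod3 _) SK.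
  by apply: mem_of_size; rewrite ?size_map ?sz ?card_mod3.
case/mapP => s; rewrite memK => Ns es.
have [|t et] := @mod3_eq0 _ (z - s); first by rewrite mod3B es subrr.
by exists s, t; rewrite -et addrC subrK.
Qed.

Section Direction.
Variable v : 'rV[int]_n.+1.
Hypotheses (v0 : v != 0) (Nv : N v < 1) (vmin : forall z, z != 0 -> N v <= N z).

(** If [v] were [3 t], then [t] would be a shorter nonzero vector. *)
Lemma direction_mod3 : exists i, mod3 v 0 i != 0.
Proof.
apply/not_existsP => H; have [|t et] := @mod3_eq0 _ v.
  by apply/rowP => i; rewrite [RHS]mxE; apply/eqP/negPn/negP/H.
have t0 : t != 0 by apply: contraNneq v0 => t0; rewrite et t0 mul0rn.
have := vmin t0; rewrite et (normMn Nn); have := Ngt0 t0; lra.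
Qed.

Lemma direction_exponent : exists m, [/\ (0 < m)%N, N (v *+ m) < 1 & 1 <= N (v *+ m.+1)].
Proof.
have ex : exists k, 1 <= N (v *+ k).
  exists (Num.bound (N v)^-1); rewrite (normMn Nn) -ler_pdivrMr ?Ngt0 // div1r.
  by apply/ltW/archi_boundP; rewrite invr_ge0 ltW ?Ngt0.
have [k hk kmin] := ex_minnP ex.
case: k hk kmin => [|[|m]] hk kmin.
- by move: hk; rewrite mulr0n (norm0 Nn) ler10.
- by move: hk; rewrite mulr1n leNgt Nv.
exists m.+1; split=> //; rewrite ltNge; apply/negP => /kmin; by rewrite ltnn.
Qed.

(** [P] vanishes exactly on the vectors parallel to [v], and a functional generic for the finitely
    many differences of points of [SK] is composed with it. *)
Lemma direction_height : exists h : 'rV[int]_n.+1 -> int,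
  [/\ forall x y, h (x - y) = h x - h y, h v = 0 &
      forall x y, x \in SK -> y \in SK -> h x = h y -> exists c, x - y = v *~ c].
Proof.
have [i vi] : exists i, v 0 i != 0.
  apply/not_existsP => H; case/negP: v0; apply/eqP/rowP => i.
  by rewrite [RHS]mxE; apply/eqP/negPn/negP/H.
pose P (z : 'rV[int]_n.+1) : 'rV[int]_n.+1 := v 0 i *: z - z 0 i *: v.
have PB x y : P (x - y) = P x - P y.
  by apply/rowP => j; rewrite !mxE; ring.
have [t ht] := separating_functional [seq P (x - y) | x <- SK, y <- SK].
exists (fun z => (rVpoly (P z)).[t]); split.
- by move=> x y; rewrite PB raddfB /= hornerD hornerN.
- by rewrite /P subrr raddf0 horner0.
move=> x y xK yK e; set z := x - y.
have Pz : P z = 0.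
  apply: ht; first by apply: allpairs_f.
  by rewrite PB raddfB /= hornerD hornerN e subrr.
have zv : z *~ v 0 i = v *~ z 0 i.
  by move/eqP: Pz; rewrite /P subr_eq0 => /eqP; rewrite !scalez.
pose q := divz (z 0 i) (v 0 i); exists q.
apply/eqP; rewrite -subr_eq0; apply/negPn/negP => z'0.
have := vmin z'0; rewrite leNgt => /negP; apply.
have vR : (0 : R) < `|v 0 i|%:~R by rewrite ltr0z normr_gt0.
(* Euclidean division along the line: [v_i (z - q v)] is the remainder of [z_i] times [v], so a
   nonzero [z - q v] would be shorter than [v]. *)
rewrite -(ltr_pM2l vR) -(normMz Nn).
have -> : (z - v *~ q) *~ v 0 i = v *~ modz (z 0 i) (v 0 i).
  by rewrite mulrzBl zv -mulrzA -mulrzBr /modz.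
rewrite (normMz Nn) ltr_pM2r ?Ngt0 // ltr_int; lia.
Qed.


Section Classes.
Variable i : 'I_n.+1.
Hypothesis vi : mod3 v 0 i != 0.

(** Coordinates on the quotient of the space over ['F_3] by the line of [v]: the map kills [v], and
    its entry [i], always 0, is dropped. *)
Definition line_class (x : 'rV[int]_n.+1) : 'rV['F_3]_n :=
  col' i (mod3 v 0 i *: mod3 x - mod3 x 0 i *: mod3 v).

Lemma line_class_shift x (c : int) : line_class (x + v *~ c) = line_class x.
Proof.
apply/rowP => j; rewrite !mxE -scalez !mxE !rmorphD !rmorphM /=; ring.
Qed.

Lemma line_class_eq x y : line_class x = line_class y ->
  exists w c, x - y = w *+ 3 + v *~ c.
Proof.
(* Coordinate [i] determines by which multiple of [v] the points differ over ['F_3]; [c] lifts that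
   multiple to an integer. *)
move=> e; pose d : 'F_3 := (mod3 x 0 i - mod3 y 0 i) / mod3 v 0 i.
pose c : int := (d : nat)%:Z.
have [|w ew] := @mod3_eq0 _ (x - y - v *~ c); last by exists w, c; rewrite -ew subrK.
have cd : (c%:~R : 'F_3) = d by rewrite /c -pmulrn natr_Zp.
apply/rowP => j.
have E : mod3 v 0 i * (mod3 x 0 j - mod3 y 0 j) = (mod3 x 0 i - mod3 y 0 i) * mod3 v 0 j.
  have [->|ij] := eqVneq j i; first by rewrite mulrC.
  have [k ek] : exists k, j = lift i k.
    by case: (unliftP i j) ij => [k ->|->]; [exists k | rewrite eqxx].
  move/rowP/(_ k)/eqP: e; rewrite !mxE -ek -subr_eq0 => /eqP e.
  by apply/eqP; rewrite -subr_eq0 -e; apply/eqP; ring.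
apply: (mulfI vi); rewrite -scalez !mxE mulr0 !rmorphB /= rmorphM /= cd mulrBr.
rewrite !mxE in E; rewrite E /d !mxE.
by have := vi; rewrite mxE => vi'; field.
Qed.

Variable m : nat.
Hypotheses (m0 : (0 < m)%N) (Nm : N (v *+ m) < 1) (Nm1 : 1 <= N (v *+ m.+1)).

Let both s := N (s + v *+ m) <= 1 /\ N (s - v *+ m) <= 1.

(** The class bound is summed over the [3^n] classes. Equality makes each class a single run of
    [2m + 3] points, and [both] holds exactly at the three middle ones; these give the covering and
    the moves by [v] or [- v]. *)
Lemma direction_bound :
  (size SK <= 3 ^ n * (size SI + 2))%N /\
  (size SK = (3 ^ n * (size SI + 2))%N ->
   [/\ forall z, N z < 1 -> exists2 j : int, `|j| <= m & z = v *~ j,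
       forall z, exists s t, both s /\ z = s + t *+ 3
     & forall s, both s -> both (s + v) \/ both (s - v)]).
Proof.
have [h [hB hv hK]] := direction_height.
have smemI z : N z < 1 -> z \in SI by rewrite memI.
pose A u := [seq x <- SK | line_class x == u].
have bound u := class_bound Nn Nm Nm1 hB hv smemI (A := A u).
have {}bound u : (size (A u) <= size SI + 2)%N /\
   ((size SI + 2 <= size (A u))%N -> (size SI <= 2 * m + 1)%N /\
    exists2 y, y \in A u & run N v y (2 * m + 3)).
  apply: bound => //; first exact: filter_uniq.
  - by move=> x; rewrite mem_filter memK => /andP[].
  - move=> x y; rewrite !mem_filter => /andP[/eqP <- _] /andP[/eqP e _].
    exact: line_class_eq.
  - by move=> x y; rewrite !mem_filter => /andP[_ xK] /andP[_ yK]; apply: hK.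
have sK : size SK = (\sum_u size (A u))%N.
  by rewrite -(sum_count_fin line_class); apply: eq_bigr => u _; rewrite size_filter.
split.
  rewrite sK -(card_mod3 n) -sum_nat_const; apply: leq_sum => u _.
  by case: (bound u).
move=> eK.
have full u : (size SI + 2 <= size (A u))%N.
  rewrite leqNgt; apply/negP => lt.
  suff : (\sum_u size (A u) < 3 ^ n * (size SI + 2))%N by rewrite -sK eK ltnn.
  rewrite -(card_mod3 n) -sum_nat_const (bigD1 u) //= [ltnRHS](bigD1 u) //= -addSn.
  by apply: leq_add => //; apply: leq_sum => w _; case: (bound w).
have [gm _] := (bound 0).2 (full 0).
have line x : exists y, [/\ line_class y = line_class x, run N v y (2 * m + 3) &
    forall z, N z <= 1 -> line_class z = line_class x ->
      exists2 i, (i < 2 * m + 3)%N & z = y + v *+ i].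
  have [_ [y]] := (bound (line_class x)).2 (full _).
  rewrite mem_filter => /andP[/eqP ey yK] ry; exists y; split=> // z Nz ez.
  pose rl := [seq y + v *+ i | i <- iota 0 (2 * m + 3)].
  have url : uniq rl.
    rewrite map_inj_uniq ?iota_uniq // => a b /addrI.
    by rewrite !pmulrn => /(direction_inj Nn Nm Nm1) [].
  have sub : {subset rl <= A (line_class x)}.
    move=> w /mapP[k]; rewrite mem_iota => /andP[_ hk] ->.
    by rewrite mem_filter memK ry // pmulrn line_class_shift ey eqxx.
  have [|_ eA] := uniq_min_size url sub.
    rewrite size_map size_iota; apply: leq_trans (bound (line_class x)).1 _.
    by move: gm; clear; lia.
  have : z \in rl by rewrite eA mem_filter memK Nz ez eqxx.
  by case/mapP => k; rewrite mem_iota => /andP[_ hk] ->; exists k.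
have runz y k : run N v y (2 * m + 3) -> 0 <= k < (2 * m + 3)%N%:Z -> N (y + v *~ k) <= 1.
  by case: k => // k ry hk; rewrite -pmulrn; apply: ry.
have addz y a b : y + v *~ a + v *~ b = y + v *~ (a + b) by rewrite -addrA -mulrzDr.
split.
- move=> z Nz; pose il := [seq v *~ (k%:Z - m%:Z) | k <- iota 0 (2 * m + 1)].
  have uil : uniq il.
    rewrite map_inj_uniq ?iota_uniq // => a b /(direction_inj Nn Nm Nm1) /addIr [] //.
  have sub : {subset il <= SI}.
    move=> w /mapP[k]; rewrite mem_iota => /andP[_ hk] ->.
    by rewrite memI; apply: (norm_direction_lt1 Nn Nm); move: hk; clear; lia.
  have [|_ eI] := uniq_min_size uil sub; first by rewrite size_map size_iota.
  have : z \in il by rewrite eI memI.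
  by case/mapP => k; rewrite mem_iota => hk ->; exists (k%:Z - m%:Z) => //; move: hk; clear; lia.
- move=> z; have [y [ey ry _]] := line z.
  have [w [c e]] := line_class_eq (esym ey).
  (* [r] selects the middle point [y + (m + r) v] that agrees with [z] modulo 3. *)
  pose r := modz (c - m%:Z) 3; pose q := divz (c - m%:Z) 3.
  have hr : 0 <= r < 3 by rewrite /r; lia.
  have ec : c = m%:Z + r + q * 3%:Z by rewrite /r /q; lia.
  exists (y + v *~ (m%:Z + r)), (w + v *~ q); rewrite /both !pmulrn -mulrNz !addz.
  split; first by split; apply: runz => //; move: hr; clear; lia.
  rewrite -[LHS](subrK y) e ec mulrzDr -pmulrn mulrnDl [v *~ q *+ 3]pmulrn -mulrzA.
  by rewrite [LHS]addrC [RHS]addrACA [LHS]addrA.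
move=> s [s1 s2].
have [y [ey ry yall]] := line s.
rewrite pmulrn in s1 s2; rewrite -mulrNz in s2.
have [i1 hi1 e1] := yall _ s1 (line_class_shift _ _).
have [i2 hi2 e2] := yall _ s2 (line_class_shift _ _).
rewrite !pmulrn in e1 e2.
have es : s = y + v *~ (i2%:Z + m%:Z).
  by rewrite -addz -e2 addz addNr mulr0z addr0.
have i12 : i1%:Z = i2%:Z + m%:Z + m%:Z.
  by apply: (direction_inj Nn Nm Nm1); apply: (addrI y); rewrite -e1 es addz.
(* [i2] is 0, 1 or 2, the place of [s] among the three middle points; only the last place moves
   down. *)
have [i2small|i2big] := leqP i2 1.
  left; rewrite es -[v in _ + v]mulr1z /both !pmulrn -mulrNz !addz;
    split; apply: runz => //; move: hi1 hi2 i12 i2small; clear; lia.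
right; rewrite es -[v in _ - v]mulr1z /both !pmulrn -!mulrNz !addz;
  split; apply: runz => //; move: hi1 hi2 i12 i2big; clear; lia.
Qed.
End Classes.

End Direction.
End Bound.

(** * From integer vectors to real ones *)

Definition emb n (z : 'rV[int]_n) : vecR n := fun i => (z 0 i)%:~R.
Definition rowZ n (z : 'rV[int]_n) : vecZ n := fun i => Z_of_int (z 0 i).

Lemma IZR_Z_of_int (k : int) : IZR (Z_of_int k) = k%:~R :> R.
Proof.
have P (j : nat) : IZR (Z.of_nat j) = j%:R :> R by rewrite -INRE INR_IZR_INZ.
case: k => j; first by rewrite -pmulrn -P.
have -> : IZR (Z_of_int (Negz j)) = Ropp (IZR (Z.of_nat j.+1)) by rewrite -opp_IZR /= addn1.
rewrite P RoppE.
by rewrite NegzE mulrNz -pmulrn.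
Qed.

Lemma embZ_rowZ n (z : 'rV[int]_n) : embZ (rowZ z) = emb z.
Proof. by apply/functional_extensionality => i; apply: IZR_Z_of_int. Qed.

Lemma G_eq_rows n (S : vecR n -> Prop) (s : seq 'rV[int]_n) : uniq s ->
  (forall z, z \in s <-> S (emb z)) -> G_eq S (size s).
Proof.
move=> us hs; exists (List.map (@rowZ n) s).
have injZ : injective (@rowZ n).
  move=> x y e; apply/rowP => i; apply: (can_inj Z_of_intK).
  exact: (congr1 (fun f : vecZ n => f i) e).
have InP x : List.In x s <-> x \in s.
  elim: (s) => [|y r IH] /=; first by split.
  rewrite inE; split=> [[->|/IH ->]|/orP[/eqP ->|/IH]]; rewrite ?eqxx ?orbT; by [|left|right].
split; last split.
- apply: FinFun.Injective_map_NoDup => //.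
  elim: s us {hs InP} => [|y r IH] /=; first by constructor.
  move=> /andP[yr /IH h]; constructor=> // hy; case/negP: yr.
  by elim: (r) hy => //= z t IHt [->|/IHt]; rewrite inE ?eqxx // => ->; rewrite orbT.
- by rewrite List.length_map.
move=> z; pose y : 'rV[int]_n := \row_i int_of_Z (z i).
have zy : rowZ y = z.
  by apply/functional_extensionality => i; rewrite /rowZ mxE int_of_ZK.
rewrite -zy embZ_rowZ -hs -InP; split=> [/List.in_map_iff [w [/injZ <-]]|] //.
exact: List.in_map.
Qed.

Lemma finite_rows n (P : 'rV[int]_n -> Prop) (B : nat) :
  (forall z, P z -> forall i, `|z 0 i| <= B) ->
  exists s : seq 'rV[int]_n, uniq s /\ forall z, z \in s <-> P z.
Proof.
move=> hB.
pose f (y : 'rV['I_(2 * B + 1)]_n) : 'rV[int]_n := \row_i ((y 0 i)%:Z - B%:Z).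
exists (undup [seq z <- [seq f y | y : 'rV['I_(2 * B + 1)]_n] | `[< P z >]]).
split; first exact: undup_uniq.
move=> z; rewrite mem_undup mem_filter; split=> [/andP[/asboolP] //|Pz].
apply/andP; split; first exact/asboolP.
have lt i : (absz (z 0%R i + B%:Z)%R < 2 * B + 1)%N.
  by move: (hB z Pz i); move: (z 0 i) => k; lia.
apply/imageP; exists (\row_i Ordinal (lt i)) => //.
by apply/rowP => i; rewrite !mxE /=; move: (hB z Pz i); move: (z 0 i) => k; lia.
Qed.

Section RealNorm.
Variables (n : nat) (N : vecR n.+1 -> R).
Hypothesis ND : forall x y, (N (fun i => x i + y i) <= N x + N y)%coqR.
Hypothesis NZ : forall x t, (N (fun i => t * x i) = Rabs t * N x)%coqR.

Lemma emb_group_norm : group_norm (fun z => N (emb z)).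
Proof.
split=> [x y|x|x k].
- apply/RleP; have -> : emb (x + y) = (fun i => (emb x i + emb y i)%coqR).
    by apply/functional_extensionality => i; rewrite /emb mxE intrD.
  exact: ND.
- have -> : emb (- x) = (fun i => (-1 * emb x i)%coqR).
    by apply/functional_extensionality => i; rewrite /emb mxE RmultE mulrNz mulN1r.
  by rewrite NZ Rabs_left ?RmultE ?RoppE ?opprK ?mul1r //; Lra.lra.
- have -> : emb (x *+ k) = (fun i => (INR k * emb x i)%coqR).
    by apply/functional_extensionality => i; rewrite /emb mulmxnE RmultE INRE rmorphMn /= mulr_natl.
  by rewrite NZ Rabs_pos_eq; [rewrite INRE | exact: pos_INR].
Qed.

End RealNorm.

Lemma rsumE n (f : 'I_n -> R) : rsum f = \sum_i f i.
Proof.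
rewrite /rsum -big_enum /=; elim: (enum _) => [|i s IH] /=; first by rewrite big_nil.
by rewrite big_cons IH.
Qed.

Lemma zsumE n (f : 'I_n -> int) :
  zsum (fun i => Z_of_int (f i)) = Z_of_int (\sum_i f i).
Proof.
rewrite /zsum -big_enum /=; elim: (enum _) => [|i s IH] /=; first by rewrite big_nil.
by rewrite big_cons IH rmorphD.
Qed.

(* Transposed: the rows of [A] become the columns of the matrix acting on
   column vectors. *)
Definition zmat_of n (A : 'M[int]_n) : zmat n := fun i j => Z_of_int (A j i).

Lemma zmat_mul_of n (A B : 'M[int]_n) i j :
  zmat_mul (zmat_of A) (zmat_of B) i j = zmat_of (B *m A) i j.
Proof.
rewrite /zmat_of mxE -zsumE /zmat_mul; congr (zsum _).
by apply/functional_extensionality => k; rewrite /zmat_of mulrC rmorphM.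
Qed.

Lemma zmat_of1 n i j : @zmat_of n 1%:M i j = zmat_id i j.
Proof. by rewrite /zmat_of /zmat_id mxE eq_sym; case: eqP. Qed.

Lemma IZR_zsum n (f : 'I_n -> Z) : IZR (zsum f) = \sum_i IZR (f i).
Proof.
rewrite /zsum -big_enum /=; elim: (enum _) => [|i s IH] /=; first by rewrite big_nil.
by rewrite big_cons plus_IZR IH.
Qed.

Lemma zmat_applyK n (A B : zmat n) :
  (forall i j, zmat_mul B A i j = zmat_id i j) ->
  forall y, zmat_apply B (zmat_apply A y) = y.
Proof.
move=> BA y; apply/functional_extensionality => i.
rewrite /zmat_apply rsumE.
under eq_bigr => j _ do rewrite rsumE RmultE mulr_sumr.
rewrite exchange_big /=.
have E k : \sum_j IZR (B i j) * (IZR (A j k) * y k)%coqR = IZR (zmat_id i k) * y k.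
  rewrite -BA /zmat_mul IZR_zsum mulr_suml; apply: eq_bigr => j _.
  by rewrite mult_IZR !RmultE mulrA.
under eq_bigr => k _ do rewrite E.
rewrite (bigD1 i) //= big1 ?addr0 /zmat_id ?eqxx; first by rewrite mul1r.
by move=> k /negPf; rewrite eq_sym => ->; rewrite mul0r.
Qed.

Lemma zmat_apply_emb n (A : 'M[int]_n) z :
  zmat_apply (zmat_of A) (emb z) = emb (z *m A).
Proof.
apply/functional_extensionality => i; rewrite /zmat_apply rsumE /emb mxE.
rewrite rmorph_sum; apply: eq_bigr => j _.
by rewrite IZR_Z_of_int RmultE mulrC -rmorphM.
Qed.

(** The basis of [cube_basis] spans and is independent, so its matrix has an integer inverse and is
    square. *)
Lemma cube_matrix (R : archiRealFieldType) n (N : 'rV[int]_n -> R) (S : seq 'rV[int]_n) :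
  group_norm N -> (forall z, z != 0 -> 1 <= N z) -> (forall z, N z <= 1 -> z \in S) ->
  (forall z, exists s t, N s <= 1 /\ z = s + t *+ 3) ->
  exists E C : 'M[int]_n, [/\ E *m C = 1%:M, C *m E = 1%:M &
    forall c : 'rV[int]_n, N (c *m E) <= 1 <-> forall i, `|c 0 i| <= 1].
Proof.
move=> Nn Nge1 SP cover.
have [|//|z _|k [e [_ span small ind]]] := cube_basis Nn Nge1 (L := fun=> True) SP.
- by [].
- by have [s [t [Ns es]]] := cover z; exists s, t.
pose E : 'M[int]_(k, n) := \matrix_(i, j) e i 0 j.
have rowE c : lin_comb k e c = (\row_(i < k) c i) *m E.
  rewrite mulmx_sum_row; apply: eq_bigr => i _; rewrite mxE scalez; congr (_ *~ _).
  by apply/rowP => j; rewrite !mxE.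
pose ext (c : 'rV[int]_k) i : int := oapp (c 0) 0 (insub i).
have extE c (i : 'I_k) : ext c i = c 0 i by rewrite /ext valK.
have mulE (c : 'rV[int]_k) : c *m E = lin_comb k e (ext c).
  by rewrite rowE; congr (_ *m _); apply/rowP => i; rewrite mxE extE.
have [C CE] : exists C : 'M[int]_(n, k), C *m E = 1%:M.
  have ch (i : 'I_n) : exists c : 'rV[int]_k, delta_mx 0 i = c *m E.
    by have [c ec] := span (delta_mx 0 i) I; exists (\row_j c j); rewrite -rowE.
  have [f hf] := choice ch.
  exists (\matrix_i f i); apply/row_matrixP => i.
  by rewrite row_mul rowK -hf row1.
have inj (c : 'rV[int]_k) : c *m E = 0 -> c = 0.
  rewrite mulE => /ind h; apply/rowP => i; rewrite mxE -extE; exact: h.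
have EC : E *m C = 1%:M.
  apply/row_matrixP => i; apply/eqP; rewrite -subr_eq0; apply/eqP/inj.
  by rewrite mulmxBl -!row_mul -mulmxA CE mulmx1 mul1mx subrr.
have kn : k = n.
  by apply/eqP; rewrite eqn_leq (mulmx1_min EC) (mulmx1_min CE).
case: n / kn N S Nn Nge1 SP cover e span small ind E rowE mulE C CE inj EC
  => N S Nn Nge1 SP cover e span small ind E rowE mulE C CE inj EC.
have small' (c : 'rV[int]_k) : (forall i, `|c 0 i| <= 1) -> N (c *m E) <= 1.
  by move=> hc; rewrite mulE; apply: small => i hi; rewrite -[i]/(val (Ordinal hi)) extE.
exists E, C; split=> // c; split=> [Nc|]; last exact: small'.
(* Rounding [c / 3] leaves entries of [d] in {-1, 0, 1}. Then [c E] and [d E] are points of the ball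
   that differ by [3 q E], which forces [q = 0]. *)
pose q : 'rV[int]_k := \row_i divz (c 0 i + 1) 3.
pose d := c - q *+ 3.
have hd i : `|d 0 i| <= 1.
  by rewrite /d 2!mxE mulmxnE mxE -mulr_natr; move: (c 0 i) => x; lia.
have q0 : q = 0.
  apply: inj; apply/eqP/negPn/negP => /Nge1; apply/negP; rewrite -ltNge.
  apply: (norm_sub_mod3 Nn Nc (small' d hd)).
  by rewrite -mulmxBl /d opprB addrC subrK !mulrS !mulr0n !mulmxDl mul0mx.
by move=> i; have := hd i; rewrite /d q0 mul0rn subr0.
Qed.

Section Box.
Variables (n : nat) (N : vecR n.+1 -> R).
Hypothesis ND : forall x y, (N (fun i => x i + y i) <= N x + N y)%coqR.
Hypothesis NZ : forall x t, (N (fun i => t * x i) = Rabs t * N x)%coqR.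

(** [norm_box] is applied to [N] composed with the matrix; the last three hypotheses are its vertex
    and facet conditions at lattice points. *)
Lemma unimod_equiv_box (K : vecR n.+1 -> Prop) (E C : 'M[int]_n.+1) m :
  (forall x, K x <-> (N x <= 1)%coqR) -> E *m C = 1%:M -> C *m E = 1%:M ->
  (forall d : 'rV[int]_n.+1, (forall i, `|d 0 i| <= 1) ->
     N (emb (d *m E + row ord_max E *+ m)) <= 1 /\
     N (emb (d *m E - row ord_max E *+ m)) <= 1) ->
  (forall i, i != ord_max -> 1 <= N (emb (row i E))) ->
  1 <= N (emb (row ord_max E *+ m.+1)) ->
  unimod_equiv K (box n.+1 m.+1).
Proof.
move=> KN EC CE vert facet top.
pose A := zmat_of E; pose B := zmat_of C.
have AB i j : zmat_mul A B i j = zmat_id i j by rewrite zmat_mul_of CE zmat_of1.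
have BA i j : zmat_mul B A i j = zmat_id i j by rewrite zmat_mul_of EC zmat_of1.
pose g y := N (zmat_apply A y).
have gD x y : (g (fun i => x i + y i) <= g x + g y)%coqR.
  rewrite /g; have -> : zmat_apply A (fun i => (x i + y i)%coqR) =
      (fun i => (zmat_apply A x i + zmat_apply A y i)%coqR).
    apply/functional_extensionality => i; rewrite /zmat_apply !rsumE RplusE -big_split.
    by apply: eq_bigr => j _; rewrite !(RplusE, RmultE) mulrDr.
  exact: ND.
have gZ x t : (g (fun i => t * x i) = Rabs t * g x)%coqR.
  rewrite /g -NZ; congr N; apply/functional_extensionality => i.
  rewrite /zmat_apply !rsumE RmultE mulr_sumr.
  by apply: eq_bigr => j _; rewrite !RmultE mulrCA.
have g_emb y z : (forall i, y i = emb z i) -> g y = N (emb (z *m E)).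
  by move=> /functional_extensionality ->; rewrite /g zmat_apply_emb.
have boxg y : (g y <= 1)%coqR <-> box n.+1 m.+1 y.
  rewrite box_radiusE; apply: norm_box => // [c hc|j].
    have [d hd] : exists d : 'rV[int]_n.+1, (forall i, `|d 0 i| <= 1) /\ c = emb d.
      exists (\row_i (if c i == 1 :> R then 1 else -1)); split=> [i|].
        by rewrite mxE; case: ifP.
      apply/functional_extensionality => i; rewrite /emb mxE; case: eqP => [->|ne] //.
      by have [/ne|->] := hc i.
    case: hd => hd ->; have [v1 v2] := vert d hd.
    have rowk k : (delta_mx 0 ord_max : 'rV_n.+1) *+ k *m E = row ord_max E *+ k.
      by rewrite rowE -scaler_nat -scalemxAl scaler_nat.
    split; apply/RleP.
      rewrite (g_emb _ (d + delta_mx 0 ord_max *+ m)); first by rewrite mulmxDl rowk.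
      move=> i; rewrite /emb mxE mulmxnE mxE eqxx andTb rmorphD rmorphMn /=.
      by case: eqP => _; rewrite ?RplusE ?INRE // mul0rn.
    rewrite (g_emb _ (d - delta_mx 0 ord_max *+ m)); first by rewrite mulmxBl rowk.
    move=> i; rewrite /emb 2!mxE mulmxnE mxE eqxx andTb rmorphB rmorphMn /=.
    by case: eqP => _; rewrite ?RplusE ?RoppE ?INRE ?mul0rn ?oppr0.
  apply/RleP; rewrite /box_radius; have [->|jn] := eqVneq j ord_max.
    rewrite (g_emb _ (delta_mx 0 ord_max *+ m.+1)).
      by rewrite -scaler_nat -scalemxAl scaler_nat -rowE.
    move=> i; rewrite /emb mulmxnE mxE eqxx andTb rmorphMn /=.
    by case: eqP => _; rewrite ?mul0rn // RplusE INRE -natr1.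
  rewrite (g_emb _ (delta_mx 0 j)); first by rewrite -rowE; apply: facet.
  by move=> i; rewrite /emb mxE eqxx andTb; case: eqP.
exists A; split; first by exists B.
move=> x; rewrite KN; split=> [Nx|[y [/boxg gy exy]]].
  exists (zmat_apply B x); split; last by move=> i; rewrite zmat_applyK.
  by apply/boxg; rewrite /g zmat_applyK.
by move/functional_extensionality: exy => ->.
Qed.
End Box.

Lemma emb_add n (x y : 'rV[int]_n) : emb (x + y) = (fun i => (emb x i + emb y i)%coqR).
Proof. by apply/functional_extensionality => i; rewrite /emb mxE rmorphD. Qed.

Lemma emb_sub n (x y : 'rV[int]_n) : emb (x - y) = (fun i => (emb x i - emb y i)%coqR).
Proof. by apply/functional_extensionality => i; rewrite /emb 2!mxE rmorphB. Qed.

Lemma row_mx_perm n (d : 'rV[int]_n) (s : {perm 'I_n}) i : (d *m perm_mx s) 0 i = d 0 (s^-1%g i).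
Proof. by have := congr1 (fun A : 'rV_n => A 0 i) (col_permE s^-1 d); rewrite invgK mxE. Qed.

(** * The equality case and its converse *)

Section Body.
Variables (n : nat) (K : vecR n.+1 -> Prop) (N : vecR n.+1 -> R).
Hypotheses (bodyK : convex_body K) (symK : o_symmetric K).
Hypothesis ND : forall x y, (N (fun i => x i + y i) <= N x + N y)%coqR.
Hypothesis NZ : forall x t, (N (fun i => t * x i) = Rabs t * N x)%coqR.
Hypothesis KN : forall x, K x <-> (N x <= 1)%coqR.
Hypothesis intKN : forall x, int_set K x <-> (N x < 1)%coqR.
Hypothesis Neq0 : forall x, N x = 0%coqR -> forall i, x i = 0%coqR.
Variables SK SI : seq 'rV[int]_n.+1.
Hypotheses (uK : uniq SK) (SKP : forall z, z \in SK <-> K (emb z)).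
Hypotheses (uI : uniq SI) (SIP : forall z, z \in SI <-> int_set K (emb z)).

Let Nz z := N (emb z).
Let Nn : group_norm Nz. Proof. exact: emb_group_norm. Qed.

Let Ngt0 z : z != 0 -> 0 < Nz z.
Proof.
move=> z0; rewrite lt_neqAle (norm_ge0 Nn) andbT; apply: contraNneq z0 => /esym /Neq0 h.
by apply/eqP/rowP => i; have /eqP := h i; rewrite mxE /emb intr_eq0 => /eqP.
Qed.

Let memK z : (z \in SK) = (Nz z <= 1).
Proof. by apply/idP/RleP; rewrite -?KN; [move/SKP | move=> ?; apply/SKP]. Qed.

Let memI z : (z \in SI) = (Nz z < 1).
Proof. by apply/idP/RltP; rewrite -?intKN; [move/SIP | move=> ?; apply/SIP]. Qed.

Lemma no_interior_point : (forall z, Nz z < 1 -> z = 0) -> size SI = 1%N.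
Proof.
move=> only0; have -> : size SI = size [:: 0 : 'rV[int]_n.+1]; last by [].
apply: perm_size; apply: uniq_perm => // z; rewrite inE memI; apply/idP/eqP => [|->].
  exact: only0.
by rewrite (norm0 Nn) ltr01.
Qed.

Lemma row_unit_neq0 m (E C : 'M[int]_m) i : E *m C = 1%:M -> row i E != 0.
Proof.
move=> EC; apply/eqP => r0; have : row i (E *m C) = 0 by rewrite row_mul r0 mul0mx.
by rewrite EC row1 => /rowP /(_ i); rewrite !mxE !eqxx.
Qed.

(** This is the box with [m = 0]: the facet centres are nonzero lattice points, so their norm is at
    least 1. *)
Lemma equality_no_interior_point : (forall z, Nz z < 1 -> z = 0) ->
  size SK = (3 ^ n.+1)%N -> unimod_equiv K (box n.+1 1).
Proof.
move=> only0 sz; have [_ /(_ sz) cover] := only0_covering Nn uK memK only0.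
have Nge1 z : z != 0 -> 1 <= Nz z.
  by move=> z0; rewrite leNgt; apply: contra_neqN z0; apply: only0.
have [|E [C [EC CE EP]]] := cube_matrix Nn Nge1 (S := SK) _ cover.
  by move=> z; rewrite memK.
apply: (unimod_equiv_box ND NZ KN EC CE).
- by move=> d hd; rewrite mulr0n addr0 subr0; split; apply/EP.
- by move=> i _; apply/Nge1/(row_unit_neq0 _ EC).
by rewrite mulr1n; apply/Nge1/(row_unit_neq0 _ EC).
Qed.

Section Interior.
Variables (v : 'rV[int]_n.+1) (m : nat).
Hypotheses (v0 : v != 0) (Nm : Nz (v *+ m) < 1) (Nm1 : 1 <= Nz (v *+ m.+1)).
Hypothesis I_line : forall z, Nz z < 1 -> exists2 j : int, `|j| <= m & z = v *~ j.
Hypothesis cover : forall z, exists s t,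
  (Nz (s + v *+ m) <= 1 /\ Nz (s - v *+ m) <= 1) /\ z = s + t *+ 3.
Hypothesis three : forall s, Nz (s + v *+ m) <= 1 /\ Nz (s - v *+ m) <= 1 ->
  (Nz (s + v + v *+ m) <= 1 /\ Nz (s + v - v *+ m) <= 1) \/
  (Nz (s - v + v *+ m) <= 1 /\ Nz (s - v - v *+ m) <= 1).

Let K1 := core K (emb (v *+ m)).

Let intw : int_set K (emb (v *+ m)). Proof. by apply/intKN/RltP. Qed.

Lemma core_emb z : K1 (emb z) <-> Nz (z + v *+ m) <= 1 /\ Nz (z - v *+ m) <= 1.
Proof.
rewrite /K1 /core -emb_add -emb_sub !KN.
by split=> -[h1 h2]; split; apply/RleP.
Qed.

(** If [z] is interior to the core, [z + m v = j v] and [z - m v = k v] with [j - k = 2m] and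
    [|j|, |k| <= m], whence [j = m] and [z = 0]. So [cube_matrix] applies to the gauge of the
    core. *)
Lemma core_basis : exists E C : 'M[int]_n.+1, [/\ E *m C = 1%:M, C *m E = 1%:M &
  forall c : 'rV[int]_n.+1, K1 (emb (c *m E)) <-> forall i, `|c 0 i| <= 1].
Proof.
have [N1 [N1D N1Z K1N intK1 _]] :=
  gauge_exists (core_body bodyK symK intw) (@core_symmetric _ _ _ symK).
have N1n := emb_group_norm N1D N1Z.
have K1P z : K1 (emb z) <-> N1 (emb z) <= 1.
  by split=> [/K1N/RleP|/RleP/K1N].
have Nge1 z : z != 0 -> 1 <= N1 (emb z).
  move=> z0; rewrite leNgt; apply: contra_neqN z0 => /RltP/intK1/int_core[].
  rewrite -emb_add -emb_sub => /intKN/RltP/I_line[j hj ej] /intKN/RltP/I_line[k hk ek].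
  have jk : j - k = (m + m)%N.
    apply: (direction_inj Nn Nm Nm1); rewrite mulrzBr -ej -ek opprB addrC.
    by rewrite addrA subrK -mulrnDr -pmulrn.
  have ejm : j = m by move: jk hj hk; clear; lia.
  by apply: (addIr (v *+ m)); rewrite ej ejm add0r.
have [|z|E [C [EC CE EP]]] := cube_matrix N1n Nge1 (S := SK).
- move=> z /K1P/core_sub; rewrite memK => h; apply/RleP/KN/h => //.
- by have [s [t [hs ez]]] := cover z; exists s, t; split=> //; apply/K1P/core_emb.
by exists E, C; split=> // c; rewrite K1P.
Qed.

(* If [v] had two nonzero coordinates [c_i], [c_j] in the basis of rows of [E],
   then [c_i e_i - c_j e_j] could be moved neither by [v] nor by [- v]. *)
Lemma core_direction (E C : 'M[int]_n.+1) : E *m C = 1%:M -> C *m E = 1%:M ->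
  (forall c : 'rV[int]_n.+1, K1 (emb (c *m E)) <-> forall i, `|c 0 i| <= 1) ->
  exists i, row i E = v \/ row i E = - v.
Proof.
move=> EC CE EP; have [c vE] : exists c, v = c *m E.
  by exists (v *m C); rewrite -mulmxA CE mulmx1.
have step (x : 'rV[int]_n.+1) : (forall i, `|x 0 i| <= 1) ->
    (forall i, `|(x + c) 0 i| <= 1) \/ (forall i, `|(x - c) 0 i| <= 1).
  move=> /EP/core_emb/three; rewrite -!core_emb vE -mulmxDl -mulmxBl.
  by case=> /EP; [left | right].
have [i ci] : exists i, c 0 i != 0.
  apply/not_existsP => H; case/negP: v0; rewrite vE; apply/eqP.
  suff -> : c = 0 by rewrite mul0mx.
  by apply/rowP => i; rewrite [RHS]mxE; apply/eqP/negPn/negP/H.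
have hc j : `|c 0 j| <= 1.
  have [k|/(_ j)|/(_ j)] := step 0; first by rewrite mxE.
    by rewrite add0r.
  by rewrite sub0r mxE normrN.
have cj j : j != i -> c 0 j = 0.
  move=> ji; apply/eqP/negPn/negP => cj.
  (* Adding [c] to [x] doubles coordinate [i], and subtracting it doubles coordinate [j]. *)
  pose x : 'rV[int]_n.+1 := \row_k if k == i then c 0 i else if k == j then - c 0 j else 0.
  have [k|/(_ i)|/(_ j)] := step x.
  - by rewrite mxE; case: ifP => // _; case: ifP => // _; rewrite normrN.
  - by rewrite !mxE eqxx; move: ci; move: (c 0 i) => y; lia.
  - by rewrite !mxE (negPf ji) eqxx; move: cj; move: (c 0 j) => y; lia.
exists i.
have ec : c = c 0 i *: delta_mx 0 i.
  apply/rowP => j; rewrite !mxE eqxx; have [->|/cj ->] := eqVneq j i.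
    by rewrite mulr1.
  by rewrite mulr0.
have c1 : c 0 i = 1 \/ c 0 i = -1 by move: (hc i) ci; move: (c 0 i) => y; lia.
rewrite rowE vE ec -scalemxAl; case: c1 => ->; first by left; rewrite scale1r.
by right; rewrite scaleN1r opprK.
Qed.

(** Swapping two rows puts [v] or [- v] last; the conditions are insensitive to the sign. The other
    rows are not multiples of [v], hence not interior. *)
Lemma equality_interior_point : unimod_equiv K (box n.+1 m.+1).
Proof.
have [E [C [EC CE EP]]] := core_basis.
have [i hi] := core_direction EC CE EP.
pose s := tperm i ord_max.
pose E' := perm_mx s *m E; pose C' := C *m perm_mx s.
have ss : perm_mx s *m perm_mx s = 1%:M :> 'M[int]_n.+1.
  by rewrite -perm_mxM tperm2 perm_mx1.
have EC' : E' *m C' = 1%:M by rewrite /E' /C' mulmxA -(mulmxA _ E) EC mulmx1 ss.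
have CE' : C' *m E' = 1%:M by rewrite /E' /C' mulmxA -(mulmxA C) ss mulmx1 CE.
have row_last : row ord_max E' = v \/ row ord_max E' = - v.
  have -> : row ord_max E' = row i E; last by [].
  by apply/rowP => j; rewrite /E' -row_permE !mxE tpermR.
apply: (unimod_equiv_box ND NZ KN EC' CE').
- move=> d hd.
  have [h1 h2] : Nz (d *m E' + v *+ m) <= 1 /\ Nz (d *m E' - v *+ m) <= 1.
    rewrite -core_emb /E' mulmxA; apply/EP => j; rewrite row_mx_perm; exact: hd.
  by case: row_last => ->; rewrite ?mulNrn ?opprK.
- move=> j jn; rewrite leNgt; apply/negP => /I_line[k _ ek].
  have [k' ek'] : exists k', row j E' = row ord_max E' *~ k'.
    case: row_last => e; [exists k | exists (- k)]; rewrite e // mulrNz mulNrz opprK //.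
  (* In the basis [E'] the relation equates a unit vector with a multiple of another one. *)
  have := congr1 (mulmx^~ C') ek'; rewrite -scalez -scalemxAl -!row_mul EC' !row1.
  by move=> /rowP /(_ j); rewrite !mxE !eqxx (negPf jn) mulr0.
by rewrite -/(Nz _); case: row_last => ->; rewrite ?mulNrn ?(normN Nn).
Qed.

End Interior.

Lemma lattice_point_bound :
  (size SK <= 3 ^ n * (size SI + 2))%N /\
  (size SK = (3 ^ n * (size SI + 2))%N -> exists l, unimod_equiv K (box n.+1 l)).
Proof.
have [only0|] := pselect (forall z, Nz z < 1 -> z = 0).
  rewrite (no_interior_point only0) (_ : 3 ^ n * (1 + 2) = 3 ^ n.+1)%N; last by rewrite expnSr.
  split; first exact: (only0_covering Nn uK memK only0).1.
  by move=> sz; exists 1; apply: equality_no_interior_point.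
move=> /existsNP[z0 /not_implyP[Nz0 /eqP z00]].
pose s := [seq z <- SI | z != 0].
have [|v] := @seq_argmin R _ Nz s.
  apply/eqP => e; have : z0 \in s by rewrite mem_filter z00 memI.
  by rewrite e.
rewrite mem_filter memI => /andP[v0 Nv] hv.
have vmin z : z != 0 -> Nz v <= Nz z.
  move=> zn0; have [lt|/(lt_le_trans Nv)/ltW //] := ltP (Nz z) 1.
  by apply: hv; rewrite mem_filter zn0 memI.
have [i vi] := direction_mod3 Nn Ngt0 v0 vmin.
have [m [m0 Nm Nm1]] := direction_exponent Nn Ngt0 v0 Nv.
have [bound eq] := direction_bound Nn Ngt0 uK memK memI v0 Nv vmin vi m0 Nm Nm1.
split=> // /eq [I_line cover three]; exists m.+1.
exact: (equality_interior_point v0 Nm Nm1 I_line cover three).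
Qed.


Lemma zmat_ofP (A : zmat n.+1) : exists E : 'M[int]_n.+1, A = zmat_of E.
Proof.
exists (\matrix_(j, i) int_of_Z (A i j)).
apply/functional_extensionality => i; apply/functional_extensionality => j.
by rewrite /zmat_of mxE int_of_ZK.
Qed.

Lemma zmat_of_inv (E C : 'M[int]_n.+1) :
  (forall i j, zmat_mul (zmat_of E) (zmat_of C) i j = zmat_id i j) -> C *m E = 1%:M.
Proof.
move=> h; apply/matrixP => i j; apply: (can_inj Z_of_intK).
have := h j i; rewrite zmat_mul_of -zmat_of1; exact.
Qed.

(** Once [l = 0] is excluded, [l] denotes the predecessor: there are at most [2l + 1] interior
    points and at least [3^n (2l + 3)] points in all. *)
Lemma card_of_box l : unimod_equiv K (box n.+1 l) -> (3 ^ n * (size SI + 2) <= size SK)%N.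
Proof.
move=> [A0 [[B0 [AB BA]] hK]].
have [E eA] := zmat_ofP A0; have [C eB] := zmat_ofP B0; subst A0 B0.
have CE := zmat_of_inv AB; have EC := zmat_of_inv BA.
have Kbox x : K x <-> box n.+1 l (zmat_apply (zmat_of C) x).
  rewrite hK; split=> [[y [by_ /functional_extensionality ->]]|hx].
    by rewrite zmat_applyK.
  by exists (zmat_apply (zmat_of C) x); rewrite zmat_applyK.
have scale z t : zmat_apply (zmat_of C) (fun i => (t * emb z i)%coqR) =
    (fun i => (t * emb (z *m C) i)%coqR).
  rewrite -zmat_apply_emb; apply/functional_extensionality => i.
  rewrite /zmat_apply !rsumE RmultE mulr_sumr; apply: eq_bigr => j _.
  by rewrite !RmultE mulrCA.
case: l hK Kbox => [|l] hK Kbox.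
  (* For [l = 0] the box is flat, yet a small multiple of the point with last box coordinate 1 lies
     in [K]. *)
  exfalso; pose z := (delta_mx 0 ord_max : 'rV[int]_n.+1) *m E.
  have zC : z *m C = delta_mx 0 ord_max by rewrite /z -mulmxA EC mulmx1.
  have N0 : (0 <= N (emb z))%coqR by apply/RleP/(norm_ge0 Nn).
  pose t := (/ (N (emb z) + 1))%coqR.
  have t0 : (0 < t)%coqR by apply: Rinv_0_lt_compat; Lra.lra.
  have : K (fun i => (t * emb z i)%coqR).
    apply/KN; rewrite NZ Rabs_pos_eq; last Lra.lra.
    apply: (Rmult_le_reg_l (N (emb z) + 1)); first Lra.lra.
    by rewrite -Rmult_assoc Rinv_r ?Rmult_1_l; Lra.lra.
  move=> /Kbox; rewrite scale zC => /(_ ord_max).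
  have -> : emb (delta_mx 0 ord_max : 'rV[int]_n.+1) ord_max = 1%coqR.
    by rewrite /emb mxE !eqxx.
  by rewrite subn1 Nat.ltb_irrefl /= Rmult_1_r => -[_ /Rle_not_lt].
have Kint z t : K (fun i => (t * emb z i)%coqR) <->
    forall i, (Rabs (t * emb (z *m C) i) <= box_radius l i)%coqR.
  by rewrite Kbox scale box_radiusE.
have intr_lt (k : int) (t : R) (r : nat) : (1 < t)%coqR -> (0 < r)%N ->
    (Rabs (t * k%:~R) <= INR r)%coqR -> `|k| < r.
  move=> t1 r0 h; rewrite -(ltr_int R) intr_norm -pmulrn -INRE -RabsE; apply/RltP.
  have r0' : (0 < INR r)%coqR by apply: lt_0_INR; apply/ssrnat.ltP.
  move: h; rewrite Rabs_mult (Rabs_pos_eq t); last Lra.lra.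
  move: (Rabs_pos k%:~R) r0'; move: (Rabs _) (INR r) => a r' a0 r'0 h.
  by have [->|ne] := Req_dec a 0%coqR; Lra.nra.
have interior z : z \in SI -> (forall i, i != ord_max -> (z *m C) 0 i = 0) /\
    `|(z *m C) 0 ord_max| <= l.
  move=> /SIP/intKN Nz1.
  have N0 : (0 <= N (emb z))%coqR by apply/RleP/(norm_ge0 Nn).
  (* An interior point stays in [K] when scaled by this [t > 1], which makes the coordinate bounds
     strict. *)
  pose t := (2 / (1 + N (emb z)))%coqR.
  have tN : (t * (1 + N (emb z)) = 2)%coqR by rewrite /t /Rdiv Rmult_assoc Rinv_l; Lra.lra.
  have t1 : (1 < t)%coqR by Lra.nra.
  have h : K (fun i => (t * emb z i)%coqR).
    by apply/KN; rewrite NZ Rabs_pos_eq; Lra.nra.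
  move/Kint in h; split=> [i il|].
    have := h i; rewrite /box_radius (negPf il) => /(@intr_lt _ t 1%N t1 isT).
    by move: (_ 0 i) => k; lia.
  have := h ord_max; rewrite /box_radius eqxx -S_INR => /(@intr_lt _ t l.+1 t1 isT).
  by move: (_ 0 ord_max) => k; lia.
have SIle : (size SI <= 2 * l + 1)%N.
  pose f (z : 'rV[int]_n.+1) := (z *m C) 0 ord_max.
  rewrite -(size_map f) -(size_iota 0 (2 * l + 1)) -(size_map (fun k : nat => k%:Z - l%:Z)).
  apply: uniq_leq_size => [|k /mapP[z /interior[_ hz] ->]].
    rewrite map_inj_in_uniq // => x y /interior[x0 _] /interior[y0 _] e.
    rewrite -[x]mulmx1 -[y]mulmx1 -CE !mulmxA; congr (_ *m E); apply/rowP => i.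
    by have [-> //|il] := eqVneq i ord_max; rewrite x0 ?y0.
  apply/mapP; exists (absz (f z + l%:Z)%R); rewrite -/(f z) in hz *.
    by rewrite mem_iota; move: (f z) hz => j; lia.
  by move: (f z) hz => j; lia.
apply: (@leq_trans (3 ^ n * (2 * l + 3))).
  by rewrite leq_mul2l; apply/orP; right; lia.
(* Box coordinates of lattice points of [K]: entries in {-1, 0, 1}, and a last entry between
   [- (l + 1)] and [l + 1]. *)
pose y (p : 'rV['I_3]_n * 'I_(2 * l + 3)) : 'rV[int]_n.+1 :=
  \row_i if unlift ord_max i is Some j then (p.1 0 j)%:Z - 1 else p.2%:Z - l.+1%:Z.
have yinj : injective (fun p => y p *m E).
  move=> [a b] [a' b'] e.
  have {}e : y (a, b) = y (a', b').
    by rewrite -[LHS]mulmx1 -[RHS]mulmx1 -EC !mulmxA e.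
  congr (_, _).
    apply/rowP => j; apply: val_inj; apply/eqP; rewrite -eqz_nat; apply/eqP.
    by have := congr1 (fun M : 'rV_n.+1 => M 0 (lift ord_max j)) e; rewrite !mxE liftK => /addIr.
  apply: val_inj; apply/eqP; rewrite -eqz_nat; apply/eqP.
  by have := congr1 (fun M : 'rV_n.+1 => M 0 ord_max) e; rewrite !mxE unlift_none => /addIr.
have -> : (3 ^ n * (2 * l + 3))%N = size [seq y p *m E | p : 'rV['I_3]_n * 'I_(2 * l + 3)].
  by rewrite size_map -cardE card_prod card_mx !card_ord mul1n.
apply: uniq_leq_size; first by rewrite map_inj_uniq ?enum_uniq.
move=> z /imageP[p _ ->]; apply/SKP.
have := (Kint (y p *m E) 1%coqR).2; rewrite (_ : (fun i => _) = emb (y p *m E)); last first.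
  by apply/functional_extensionality => i; rewrite Rmult_1_l.
apply=> i; rewrite -mulmxA EC mulmx1 Rmult_1_l /emb mxE RabsE /box_radius.
case: unliftP => [j ->|->].
  have -> : (lift ord_max j == ord_max) = false by rewrite eq_sym; apply: negPf; apply: neq_lift.
  apply/RleP; rewrite -intr_norm -[1%coqR]/(1%:~R : R) ler_int.
  by have := ltn_ord (p.1 0 j); move: (nat_of_ord _) => k; lia.
rewrite eqxx INRE RplusE; apply/RleP; rewrite natr1 -intr_norm pmulrn ler_int.
by have := ltn_ord p.2; move: (nat_of_ord _) => k; lia.
Qed.

End Body.

Lemma Nat_powE a b : Nat.pow a b = expn a b.
Proof. by elim: b => // b IH; rewrite expnS -IH. Qed.

(* In nat_scope, [^] denotes [Nat.pow] from here on. *)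
From Stdlib Require Import Reals ZArith List.

Theorem theorem1p1 (n : nat) (hn : (1 <= n)%nat) (K : vecR n -> Prop) :
  convex_body K -> o_symmetric K ->
  exists gK gI : nat,
    G_eq K gK /\ G_eq (int_set K) gI /\
    (gK <= 3 ^ (n - 1) * (gI + 2))%nat /\
    ((gK = 3 ^ (n - 1) * (gI + 2))%nat <-> exists l : nat, unimod_equiv K (box n l)).
Proof.
case: n hn K => // n _ K bodyK symK.
have [N [ND NZ KN intKN Neq0]] := gauge_exists bodyK symK.
have [[_ [M hM]] _] := bodyK.
have bound (z : 'rV[int]_n.+1) : K (emb z) -> forall i, `|z ord0 i| <= Num.bound `|M|.
  move=> /hM h i; have := h i; rewrite /emb RabsE -intr_norm => /RleP hi.
  rewrite -(ler_int R) -pmulrn; apply: le_trans hi _.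
  by apply/ltW/(le_lt_trans (ler_norm M))/archi_boundP/normr_ge0.
have [SK [uK SKP]] := finite_rows bound.
have [SI [uI SIP]] := @finite_rows _ (fun z => int_set K (emb z)) _
  (fun z hz => bound z (proj2 (KN _) (Rlt_le _ _ (proj1 (intKN _) hz)))).
have [le_bound eq_bound] := lattice_point_bound bodyK symK ND NZ KN intKN Neq0 uK SKP uI SIP.
exists (size SK), (size SI); rewrite subn1 Nat_powE; split; [|split; [|split]] => //.
- exact: G_eq_rows.
- exact: G_eq_rows.
split=> [/eq_bound //|[l hl]]; apply/eqP; rewrite eqn_leq le_bound.
exact: (card_of_box ND NZ KN intKN uK SKP uI SIP hl).
Qed.
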